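(* Let $v:\mathbb{R}^2\to\mathbb{R}^2$ be a unit Lipschitz vector field with Lipschitz constant $K>0$ and let $0<T<1/K$. For $0<|t|\le T$ and $1\le p\le\infty$, the operators $M_t$ defined pointwise by $$M_t(F)(x,y)=\frac{1}{2t}\int_{-t}^{t}F\big[(x,y)+s\,v(x,y)\big]\,ds$$ map $L^p(\mathbb{R}^2)$ into $L^p(\mathbb{R}^2)$. Furthermore, for each $1\le p<\infty$ and every $F\in L^p(\mathbb{R}^2)$, $$\lim_{t\to 0}\|M_t(F)-F\|_p=0 .$$
   Context: A unit Lipschitz vector field on $\mathbb{R}^2$ with Lipschitz constant $K$ is a map $v:\mathbb{R}^2\to\mathbb{R}^2$ with $\|v(X)\|_2=1$ for all $X$ and $\|v(X)-v(Y)\|\le K\|X-Y\|$ for all $X,Y$. $L^p$ spaces are with respect to Lebesgue measure on $\mathbb{R}^2$. *)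

(* Defs.v *)
From mathcomp Require Import all_boot all_order all_algebra.
From mathcomp Require Import all_classical all_reals all_analysis.
Set Implicit Arguments.
Unset Strict Implicit.
Unset Printing Implicit Defensive.
Import Order.TTheory GRing.Theory Num.Theory.
Import numFieldNormedType.Exports.
Local Open Scope classical_set_scope.
Local Open Scope ring_scope.

(* The norm that the library puts on [R * R] is the max norm, hence this
   separate definition. *)
Definition euclid_norm (R : realType) (X : R * R) : R :=
  Num.sqrt (X.1 ^+ 2 + X.2 ^+ 2).

Definition unit_lipschitz_field (R : realType) (K : R)
    (v : R * R -> R * R) : Prop :=
  (forall X, euclid_norm (v X) = 1) /\
  (forall X Y, euclid_norm (v X - v Y) <= K * euclid_norm (X - Y)).

(* This measure lives on the Borel sets of the plane. A Lebesgue measurable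
   function is one that agrees almost everywhere with a Borel function, so
   [Lfun (lebesgue2 R) p] has a representative of every class of L^p. *)
Definition lebesgue2 (R : realType) :
    {measure set (measurableTypeR R * measurableTypeR R) -> \bar R} :=
  (@lebesgue_measure R \x @lebesgue_measure R)%E.

(* Lebesgue integral from a to b, with the usual sign convention if b < a. *)
Definition oriented_Rintegral (R : realType) (a b : R) (f : R -> R) : R :=
  if a <= b then \int[@lebesgue_measure R]_(s in `[a, b]) f s
  else - \int[@lebesgue_measure R]_(s in `[b, a]) f s.

Definition line_average (R : realType) (v : R * R -> R * R) (t : R)
    (F : R * R -> R) : R * R -> R :=
  fun X => (2 * t)^-1 *
    oriented_Rintegral (- t) t (fun s => F (X + s *: v X)).

(* Main.v *)
From HB Require Import structures.
Require Import Defs.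
From mathcomp Require Import all_boot all_order all_algebra.
From mathcomp Require Import all_classical all_reals all_analysis.
From mathcomp Require Import measurable_realfun ess_sup_inf ring lra.
Import Order.TTheory GRing.Theory Num.Theory.
Import numFieldNormedType.Exports.
Local Open Scope classical_set_scope.
Local Open Scope ring_scope.

(** For [|s| <= T < 1/K] the map [X |-> X + s v(X)] expands Euclidean distances
    by a factor at least [1 - TK], so the preimage of a dyadic square has
    diameter, hence area, comparable to that of the square. Since every Borel
    set is approximated in measure by unions of dyadic squares, the pull-back
    of Lebesgue measure is at most [C] times Lebesgue measure, where
    [C = 16 / (1 - TK)^2]. With Jensen's inequality and Tonelli's theorem this
    gives [||M_t F||_p <= C^(1/p) ||F||_p]. The same approximation shows that
    bounded functions that are constant on dyadic squares of some fixed size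
    and vanish off a box are dense in [L^p] for [p < oo]; for such a function
    [H], [M_t H (X) = H X] for small [t] unless [X] lies on the grid, so
    dominated convergence applies, and the uniform bound extends the
    convergence to all of [L^p]. *)

(** The field is merely Lipschitz, so a Jacobian bound for [X |-> X + s v(X)] would rest on
    differentiability almost everywhere and a change of variables. Comparing two measures cell by
    cell uses only the expansion inequality and asks nothing about the image of the map. The price
    is a constant that is not sharp; what matters is that it is the same for all [|s| <= T], since
    it is integrated in [s] by Tonelli and must not blow up as [t] tends to 0 in the density
    argument. The passage from cells to Borel sets is made inside boxes, where both measures are
    finite, and the boxes then exhaust the plane. A segment is a null set of the plane, so it is not
    clear beforehand that [F] is integrable along it, nor that the average depends only on the class
    of [F]. Both hold for almost every starting point: Tonelli shows that almost every segment meets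
    a given null set in zero length. *)

Notation plane R := (measurableTypeR R * measurableTypeR R)%type.

(** * Dyadic cells *)

Definition dyadic_index {R : realType} (n : nat) (X : plane R) : int * int :=
  (Num.floor (2 ^+ n * (X.1 : R)), Num.floor (2 ^+ n * (X.2 : R))).

(** These are the unions of cells of side [2^-n]. Describing them through the index makes
    complements, unions, intersections and refinement immediate. *)
Definition dyadic_saturated {R : realType} (n : nat) (E : set (plane R)) :=
  forall X Y, dyadic_index n X = dyadic_index n Y -> E X -> E Y.

Definition dyadic_cell (R : realType) (n : nat) (k : int * int) :
    set (plane R) :=
  [set` `[(k.1%:~R / 2 ^+ n : R), ((k.1 + 1)%:~R / 2 ^+ n)[] `*`
  [set` `[(k.2%:~R / 2 ^+ n : R), ((k.2 + 1)%:~R / 2 ^+ n)[].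

(** This makes the grids nested. The integer [c * floor x] is at most [c * x], hence at most
    [floor (c * x) = floor (c * y)], hence at most [c * y]. *)
Lemma floor_natM_inj {R : realType} {c : nat} {x y : R} : (0 < c)%N ->
  Num.floor (c%:R * x) = Num.floor (c%:R * y) -> Num.floor x = Num.floor y.
Proof.
move=> c0; have c0R : 0 < c%:R :> R by rewrite ltr0n.
wlog suff h : x y / Num.floor (c%:R * x) = Num.floor (c%:R * y) ->
    Num.floor x <= Num.floor y.
  by move=> e; apply/eqP; rewrite eq_le !h.
move=> e; rewrite floor_ge_int.
rewrite -(ler_pM2l c0R).
have -> : c%:R * (Num.floor x)%:~R = (c%:Z * Num.floor x)%:~R :> R.
  by rewrite intrM.
rewrite -floor_ge_int -e floor_ge_int intrM ler_pM2l//.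
exact: floor_le.
Qed.

Lemma exists_exp2V_lt {R : realType} {d : R} : 0 < d ->
  exists n, (2 ^+ n)^-1 < d.
Proof.
move=> d0; exists (Num.bound d^-1).
rewrite invf_plt ?posrE ?exprn_gt0//.
apply: (lt_trans (archi_boundP _)); first by rewrite invr_ge0 ltW.
by rewrite -natrX ltr_nat ltn_expl.
Qed.

Lemma dyadic_indexS {R : realType} {m n : nat} {X Y : plane R} : (m <= n)%N ->
  dyadic_index n X = dyadic_index n Y ->
  dyadic_index m X = dyadic_index m Y.
Proof.
move=> mn; rewrite /dyadic_index -(subnK mn) exprD -!mulrA -natrX.
have p0 : (0 < 2 ^ (n - m))%N by rewrite expn_gt0.
by move=> [/(floor_natM_inj p0) -> /(floor_natM_inj p0) ->].
Qed.

Lemma dyadic_saturatedS {R : realType} {m n : nat} {E : set (plane R)} :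
  (m <= n)%N -> dyadic_saturated m E -> dyadic_saturated n E.
Proof. by move=> mn sE X Y /(dyadic_indexS mn); exact: sE. Qed.

Lemma dyadic_saturatedC {R : realType} n (E : set (plane R)) :
  dyadic_saturated n E -> dyadic_saturated n (~` E).
Proof. by move=> sE X Y XY + EY; apply; apply: sE EY. Qed.

Lemma dyadic_saturatedU {R : realType} n (E F : set (plane R)) :
  dyadic_saturated n E -> dyadic_saturated n F ->
  dyadic_saturated n (E `|` F).
Proof.
by move=> sE sF X Y XY [EX|FX]; [left; exact: sE EX|right; exact: sF FX].
Qed.

Lemma dyadic_saturatedI {R : realType} n (E F : set (plane R)) :
  dyadic_saturated n E -> dyadic_saturated n F ->
  dyadic_saturated n (E `&` F).
Proof.
by move=> sE sF X Y XY [EX FX]; split; [exact: sE EX|exact: sF FX].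
Qed.

Lemma mem_dyadic_cell {R : realType} n k (X : plane R) :
  dyadic_cell R n k X <-> dyadic_index n X = k.
Proof.
have p0 : 0 < 2 ^+ n :> R by rewrite exprn_gt0.
case: k => i j; rewrite /dyadic_cell /dyadic_index /=.
rewrite !in_itv /= !ler_pdivrMr// !ltr_pdivlMr// ![_ * 2 ^+ n]mulrC.
by rewrite -!floor_eq; split => [[/eqP -> /eqP ->]|[-> ->]].
Qed.

Lemma dyadic_cell_close {R : realType} {n} {X Y : plane R} :
  dyadic_index n X = dyadic_index n Y ->
  `|X.1 - Y.1| <= (2 ^+ n)^-1 /\ `|X.2 - Y.2| <= (2 ^+ n)^-1.
Proof.
have p0 : 0 < 2 ^+ n :> R by rewrite exprn_gt0.
have aux (x y : R) : Num.floor (2 ^+ n * x) = Num.floor (2 ^+ n * y) ->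
    `|x - y| <= (2 ^+ n)^-1.
  move=> e; rewrite -(ler_pM2l p0) divff ?gt_eqF//.
  rewrite -[X in X * _](gtr0_norm p0) -normrM mulrBr.
  have := floor_itv (2 ^+ n * x); have := floor_itv (2 ^+ n * y).
  rewrite e; set a := 2 ^+ n * x; set b := 2 ^+ n * y; set k := (Num.floor b)%:~R.
  rewrite intrD -/k ler_norml => /andP[? ?] /andP[? ?]; apply/andP; lra.
by move=> [/aux ? /aux ?].
Qed.

Lemma measurable_dyadic_cell {R : realType} n k :
  measurable (dyadic_cell R n k).
Proof. by apply: measurableX; exact: measurable_itv. Qed.

Lemma lebesgue2_rect {R : realType} (A B : set (measurableTypeR R)) :
  measurable A -> measurable B ->
  lebesgue2 R (A `*` B) = (lebesgue_measure A * lebesgue_measure B)%E.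
Proof. exact: product_measure1E. Qed.

Lemma lebesgue2_dyadic_cell {R : realType} n k :
  lebesgue2 R (dyadic_cell R n k) = ((2 ^+ n)^-1 ^+ 2)%:E.
Proof.
have p0 : 0 < (2 ^+ n)^-1 :> R by rewrite invr_gt0 exprn_gt0.
rewrite lebesgue2_rect; [|exact: measurable_itv|exact: measurable_itv].
have aux (i : int) : lebesgue_measure
   [set` `[(i%:~R / 2 ^+ n : R), ((i + 1)%:~R / 2 ^+ n)[] = ((2 ^+ n)^-1)%:E.
  rewrite lebesgue_measure_itv/= lte_fin ltr_pM2r// ltr_int ltrDl ltr01.
  by rewrite -EFinB -mulrBl -intrB addrC addKr mul1r.
by rewrite !aux -EFinM -expr2.
Qed.

Lemma dyadic_saturated_bigcup {R : realType} n (E : set (plane R)) :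
  dyadic_saturated n E ->
  exists D : set nat, exists2 k : nat -> int * int,
    E = \bigcup_(i in D) dyadic_cell R n (k i) &
    trivIset D (fun i => dyadic_cell R n (k i)).
Proof.
move=> sE.
(* [pickle_inv] decodes only genuine codes, so distinct indices in the index set give distinct
   cells, as disjointness demands. The default [(0, 0)] is met only outside that set. *)
pose k i : int * int := odflt (0, 0) (pickle_inv i).
exists [set i | (exists l : int * int, pickle_inv i = Some l) /\
   dyadic_cell R n (k i) `<=` E], k.
  apply/seteqP; split => [X EX|X [i [_ iE]]]; last exact: iE.
  exists (pickle (dyadic_index n X)); last first.
    by apply/mem_dyadic_cell; rewrite /k pickleK_inv.
  split; first by exists (dyadic_index n X); rewrite pickleK_inv.
  rewrite /k pickleK_inv /= => Y /mem_dyadic_cell XY.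
  exact: sE (esym XY) EX.
move=> i j /= [[ki kiE] _] [[kj kjE] _] [X []].
move=> /mem_dyadic_cell + /mem_dyadic_cell; rewrite /k kiE kjE /= => -> e.
move: kjE; rewrite -e => kjE.
have := @pickle_invK (int * int)%type i.
have := @pickle_invK (int * int)%type j.
rewrite /ocancel/= kiE kjE /=.
by move=> -> ->.
Qed.

Lemma measurable_dyadic_saturated {R : realType} {n} {E : set (plane R)} :
  dyadic_saturated n E -> measurable E.
Proof.
move=> /dyadic_saturated_bigcup [D [k -> _]]; apply: bigcup_measurable => i _.
exact: measurable_dyadic_cell.
Qed.

Lemma le_measure_dyadic_saturated {R : realType}
    {m1 m2 : {measure set (plane R) -> \bar R}} {n} {E : set (plane R)} :
  (forall k, (m1 (dyadic_cell R n k) <= m2 (dyadic_cell R n k))%E) ->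
  dyadic_saturated n E -> (m1 E <= m2 E)%E.
Proof.
move=> m12 /dyadic_saturated_bigcup [D [k -> tD]].
rewrite !measure_bigcup//; last 2 first.
  by move=> *; exact: measurable_dyadic_cell.
  by move=> *; exact: measurable_dyadic_cell.
exact: lee_nneseries.
Qed.

(** * Approximation of Borel sets by dyadic sets *)

(** Measurability is part of the predicate, so that the sets satisfying it form a sigma-algebra to
    which the Borel sets can be compared. *)
Definition dyadic_approximable {R : realType}
    (mu : {measure set (plane R) -> \bar R}) (A : set (plane R)) :=
  measurable A /\ forall e : R, 0 < e -> exists n, exists2 E,
    dyadic_saturated n E & (mu (A `+` E) < e%:E)%E.

Section dyadic_approximation.
Context {R : realType} (mu : {measure set (plane R) -> \bar R}).
Hypothesis mu_fin : (mu setT < +oo)%E.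

Let mY (A B : set (plane R)) :
  measurable A -> measurable B -> measurable (A `+` B).
Proof. by move=> mA mB; apply: measurableU; exact: measurableD. Qed.

Lemma dyadic_approximable_saturated n E :
  dyadic_saturated n E -> dyadic_approximable mu E.
Proof.
move=> sE; split; first exact: measurable_dyadic_saturated sE.
by move=> e e0; exists n, E => //; rewrite /setY setDv setU0 measure0 lte_fin.
Qed.

Lemma dyadic_approximableC A :
  dyadic_approximable mu A -> dyadic_approximable mu (~` A).
Proof.
move=> [mA hA]; split; first exact: measurableC.
move=> e /hA[n [E sE AE]]; exists n, (~` E); first exact: dyadic_saturatedC.
suff -> : ~` A `+` ~` E = A `+` E by [].
by rewrite /setY !setDE !setCK setUC; congr (_ `|` _); exact: setIC.
Qed.

Lemma dyadic_approximableU A B : dyadic_approximable mu A ->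
  dyadic_approximable mu B -> dyadic_approximable mu (A `|` B).
Proof.
move=> [mA hA] [mB hB]; split; first exact: measurableU.
move=> e e0; have e20 : 0 < e / 2 by rewrite divr_gt0.
have [n [E sE AE]] := hA _ e20; have [m [F sF BF]] := hB _ e20.
have {}sE := dyadic_saturatedS (leq_maxl n m) sE.
have {}sF := dyadic_saturatedS (leq_maxr n m) sF.
exists (maxn n m), (E `|` F); first exact: dyadic_saturatedU.
have mE := measurable_dyadic_saturated sE.
have mF := measurable_dyadic_saturated sF.
apply: (@le_lt_trans _ _ (mu ((A `+` E) `|` (B `+` F)))).
  apply: le_measure; rewrite ?inE.
  - by apply: mY; exact: measurableU.
  - by apply: measurableU; exact: mY.
  - by rewrite /setY => X /=; tauto.
apply: (le_lt_trans (measureU2 _ _ _)); [exact: mY|exact: mY|].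
by rewrite [in ltRHS](splitr e) EFinD lteD.
Qed.

(** Since [mu] is finite, the part of the union missed by the first [n] sets has measure tending to
    0. A dyadic set close to the finite union is then close to the whole union. *)
Lemma dyadic_approximable_bigcup (A : (set (plane R))^nat) :
  (forall i, dyadic_approximable mu (A i)) ->
  dyadic_approximable mu (\bigcup_i A i).
Proof.
move=> hA; have mA i : measurable (A i) by have [] := hA i.
set V := \bigcup_i A i; have mV : measurable V by exact: bigcupT_measurable.
split=> // e e0; have e20 : 0 < e / 2 by rewrite divr_gt0.
pose U n := \big[setU/set0]_(i < n) A i.
have hU n : dyadic_approximable mu (U n).
  rewrite /U; elim: n => [|n ih].
    by rewrite big_ord0; apply: (@dyadic_approximable_saturated 0).
  by rewrite big_ord_recr /=; exact: dyadic_approximableU.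
have mUn n : measurable (U n) by have [] := hU n.
have UE : \bigcup_n U n = V.
  apply/seteqP; split=> [X [n _]|X [n _ AX]].
    by rewrite /U -bigcup_mkord => -[i _ AX]; exists i.
  by exists n.+1 => //; rewrite /U -bigcup_mkord; exists n => /=.
have fin B : measurable B -> mu B \is a fin_num.
  move=> mB; rewrite ge0_fin_numE//; apply: le_lt_trans mu_fin.
  by apply: le_measure; rewrite ?inE.
have [n Un] : exists n, (mu (V `\` U n) < (e / 2)%:E)%E.
  have : mu (V `\` U n) @[n --> \oo] --> 0%E.
    have cap0 : \bigcap_n (V `\` U n) = set0.
      apply/seteqP; split => [X VU|//]; have [VX _] := VU 0%N I.
      by move: VX; rewrite -UE => -[n _ UnX]; have [_] := VU n I; apply.
    rewrite -(measure0 mu) -cap0; apply: nonincreasing_cvg_mu => //.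
    - by rewrite -ge0_fin_numE// fin//; exact: measurableD.
    - by move=> n; exact: measurableD.
    - by apply: bigcapT_measurable => n; exact: measurableD.
    - move=> m n mn; apply/subsetPset => X [VX UX]; split=> // UmX; apply: UX.
      exact: (@subset_bigsetU _ A m n mn X).
  move=> /(_ [set x | (x < (e / 2)%:E)%E]) []; last first.
    by move=> n _ /(_ n (leqnn n)); exists n.
  by apply: open_nbhs_nbhs; split; [exact: open_ereal_lt_ereal|rewrite /= lte_fin].
have [m [E sE UnE]] := (hU n).2 _ e20.
have mE := measurable_dyadic_saturated sE.
exists m, E => //.
apply: (@le_lt_trans _ _ (mu ((V `\` U n) `|` (U n `+` E)))).
  apply: le_measure; rewrite ?inE.
  - exact: mY.
  - by apply: measurableU; [exact: measurableD|exact: mY].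
  - have UnS : U n `<=` V by rewrite -UE; exact: bigcup_sup.
    move=> X /= [[VX EX]|[EX VX]];
      have [UnX|UnX] := pselect (U n X); [right;left|left|by have := UnS _ UnX|right;right] => //.
apply: (le_lt_trans (measureU2 _ _ _)); [exact: measurableD|exact: mY|].
by rewrite [in ltRHS](splitr e) EFinD lteD.
Qed.

(** The approximable sets form a sigma-algebra, so it is enough to reach the measurable rectangles.
    These are intersections of two cylinders, and the cylinders are reached from those over open
    half-lines. *)
Lemma dyadic_approximation A : measurable A -> dyadic_approximable mu A.
Proof.
have sigma : sigma_algebra setT (dyadic_approximable mu).
  split.
  - exact: (@dyadic_approximable_saturated 0).
  - by move=> B ?; rewrite setTD; exact: dyadic_approximableC.
  - exact: dyadic_approximable_bigcup.
have cyl (pr : plane R -> R) :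
    (forall n X Y, dyadic_index n X = dyadic_index n Y ->
       Num.floor (2 ^+ n * pr X) = Num.floor (2 ^+ n * pr Y)) ->
    forall B : set (measurableTypeR R), measurable B ->
      dyadic_approximable mu (pr @^-1` B).
  move=> prE B mB; rewrite RGenOInfty.measurableE in mB.
  move: B mB.
  apply: (smallest_sub (X := fun B => dyadic_approximable mu (pr @^-1` B))).
    have [s0 sC sU] := sigma; split.
    - by rewrite preimage_set0.
    - by move=> B hB; rewrite setTD preimage_setC -setTD; exact: sC.
    - by move=> F hF; rewrite preimage_bigcup; exact: sU.
  move=> _ [x ->].
  (* A coordinate exceeds [x] exactly when at some scale the lower edge of its cell does: once
     [2^-n] is less than the gap, rounding down loses less than the gap. *)
  rewrite [X in dyadic_approximable mu X](_ : _ = \bigcup_n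
      [set X | 2 ^+ n * x < (Num.floor (2 ^+ n * pr X))%:~R]); last first.
    apply/seteqP; split=> [X /=|X [n _ /=]].
      rewrite in_itv/= andbT => xX.
      have [n h] := exists_exp2V_lt (etrans (subr_gt0 _ _) xX).
      exists n => //=; have p0 : 0 < 2 ^+ n :> R by rewrite exprn_gt0.
      have := floorD1_gt (2 ^+ n * pr X); rewrite intrD => hf.
      have : 1 < 2 ^+ n * (pr X - x) by rewrite -ltr_pdivrMl// mulr1.
      by rewrite mulrBr; move: hf; set k := (Num.floor _)%:~R; lra.
    rewrite in_itv/= andbT => h.
    have p0 : 0 < 2 ^+ n :> R by rewrite exprn_gt0.
    by rewrite -(ltr_pM2l p0) (lt_le_trans h)// floor_le.
  apply: dyadic_approximable_bigcup => n.
  by apply: (@dyadic_approximable_saturated n) => X Y /prE /= ->.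
rewrite measurable_prod_measurableType.
apply: (smallest_sub (X := dyadic_approximable mu)) => //.
move=> _ [B mB [C mC <-]].
have -> : B `*` C = ~` (~` (fst @^-1` B) `|` ~` (snd @^-1` C)).
  by rewrite setCU !setCK.
apply: dyadic_approximableC; apply: dyadic_approximableU;
  apply: dyadic_approximableC.
- by apply: cyl => // n X Y [].
- by apply: cyl => // n X Y [].
Qed.

End dyadic_approximation.

(** * Euclidean geometry of the plane *)

Lemma euclid_norm_ge0 {R : realType} (X : R * R) : 0 <= euclid_norm X.
Proof. exact: sqrtr_ge0. Qed.

Lemma sqr_euclid_norm {R : realType} (X : R * R) :
  euclid_norm X ^+ 2 = X.1 ^+ 2 + X.2 ^+ 2.
Proof. by rewrite sqr_sqrtr// addr_ge0// sqr_ge0. Qed.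

Lemma euclid_norm_le {R : realType} (X : R * R) (r : R) : 0 <= r ->
  (euclid_norm X <= r) = (X.1 ^+ 2 + X.2 ^+ 2 <= r ^+ 2).
Proof.
move=> r0; rewrite -sqr_euclid_norm ler_sqr// nnegrE ?euclid_norm_ge0//.
Qed.

Lemma ler_norm1_euclid {R : realType} (X : R * R) : `|X.1| <= euclid_norm X.
Proof. by rewrite -sqrtr_sqr ler_wsqrtr// lerDl sqr_ge0. Qed.

Lemma ler_norm2_euclid {R : realType} (X : R * R) : `|X.2| <= euclid_norm X.
Proof. by rewrite -sqrtr_sqr ler_wsqrtr// lerDr sqr_ge0. Qed.

Lemma euclid_norm_ler {R : realType} (X : R * R) :
  euclid_norm X <= `|X.1| + `|X.2|.
Proof.
rewrite euclid_norm_le ?addr_ge0// -(real_normK (num_real X.1)).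
rewrite -(real_normK (num_real X.2)) sqrrD lerD2r lerDl.
by rewrite mulrn_wge0// mulr_ge0.
Qed.

Lemma euclid_normZ {R : realType} (a : R) (X : R * R) :
  euclid_norm (a *: X) = `|a| * euclid_norm X.
Proof. by rewrite /euclid_norm /= !exprMn -mulrDr sqrtrM ?sqr_ge0// sqrtr_sqr. Qed.

Lemma ler_euclid_normD {R : realType} (X Y : R * R) :
  euclid_norm (X + Y) <= euclid_norm X + euclid_norm Y.
Proof.
have X0 := euclid_norm_ge0 X; have Y0 := euclid_norm_ge0 Y.
rewrite euclid_norm_le ?addr_ge0// [leRHS]sqrrD !sqr_euclid_norm /=.
suff h : X.1 * Y.1 + X.2 * Y.2 <= euclid_norm X * euclid_norm Y by nra.
rewrite -sqrtrM ?addr_ge0 ?sqr_ge0//.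
rewrite (le_trans (ler_norm _))// -sqrtr_sqr ler_wsqrtr//.
(* Cauchy-Schwarz by Lagrange's identity: this square is the difference of the two sides squared. *)
by have := sqr_ge0 (X.1 * Y.2 - X.2 * Y.1); nra.
Qed.

(** A superlevel set of [f] is the union over [n] of the cells of generation [n] contained in it,
    because [f] varies little on a small cell. *)
Lemma measurable_lipschitz {R : realType} (L : R) (f : R * R -> R) :
  (forall X Y, `|f X - f Y| <= L * euclid_norm (X - Y)) ->
  measurable_fun [set: plane R] (f : plane R -> R).
Proof.
move=> fL mD; apply: (measurability _ (RGenOInfty.measurableE R)) => //.
move=> _ [_ [x ->] <-]; rewrite setTI.
rewrite [X in measurable X](_ : _ = \bigcup_n
    [set X : plane R | forall Y, dyadic_index n X = dyadic_index n Y -> x < f Y]).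
  apply: bigcupT_measurable => n.
  by apply: (@measurable_dyadic_saturated _ n) => X Y XY h Z YZ; apply: h; rewrite XY.
apply/seteqP; split => [X|X [n _ /(_ X erefl)]]; rewrite /= in_itv/= andbT//.
rewrite -subr_gt0 => fX.
(* [|L| + 1] is a positive bound for [L], so one may divide by it; the factor 2 comes from two
   points of a cell being at distance at most [2 * 2^-n]. *)
have L0 : 0 < (`|L| + 1) * 2 by rewrite mulr_gt0// ltr_wpDl.
have [n] := exists_exp2V_lt (divr_gt0 fX L0); rewrite ltr_pdivlMr// => h.
exists n => //= Y /dyadic_cell_close [h1 h2].
rewrite -subr_gt0 -(ltrD2l (f X - f Y)) addr0 [ltRHS]addrA subrK.
apply: le_lt_trans h; apply: (le_trans (ler_norm _)); apply: (le_trans (fL _ _)).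
have e0 := euclid_norm_ge0 (X - Y : R * R).
have h3 : euclid_norm (X - Y : R * R) <= 2 * (2 ^+ n)^-1.
  by apply: (le_trans (euclid_norm_ler _)); rewrite mulr_natl mulr2n lerD.
rewrite [leRHS]mulrC -mulrA.
apply: (@le_trans _ _ ((`|L| + 1) * euclid_norm (X - Y : R * R))).
  by rewrite ler_wpM2r// ler_wpDr// ler_norm.
by rewrite ler_wpM2l// ltW// ltr_wpDl.
Qed.

Lemma measurable_lipschitz_field {R : realType} {K : R} {v : R * R -> R * R} :
  unit_lipschitz_field K v ->
  measurable_fun [set: plane R] (fun X : plane R => (v X).1 : R) /\
  measurable_fun [set: plane R] (fun X : plane R => (v X).2 : R).
Proof.
move=> [_ vK]; split; apply: (@measurable_lipschitz _ K) => X Y.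
- exact: le_trans (ler_norm1_euclid (v X - v Y)) (vK X Y).
- exact: le_trans (ler_norm2_euclid (v X - v Y)) (vK X Y).
Qed.

(** * The flow along the field distorts areas boundedly *)

(** A straight displacement along [v X], not the solution of the differential equation of [v]; there
    is no group law in [s]. *)
Definition flow {R : realType} (v : R * R -> R * R) (s : R) (X : plane R) :
  plane R := (X : R * R) + s *: v X.

(** Tonelli needs measurability jointly in the point and the time; both kinds of sections follow
    from it. *)
Lemma measurable_flow2 {R : realType} {K : R} {v : R * R -> R * R} :
  unit_lipschitz_field K v ->
  measurable_fun [set: plane R * measurableTypeR R]
    (fun Z : plane R * measurableTypeR R => flow v Z.2 Z.1).
Proof.
move=> /measurable_lipschitz_field [mv1 mv2].
have mX : measurable_fun [set: plane R * measurableTypeR R] (fun Z => Z.1).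
  exact: measurable_fst.
have ms : measurable_fun [set: plane R * measurableTypeR R]
  (fun Z => Z.2 : R) by exact: measurable_snd.
apply: (@measurable_fun_pair _ _ _ _ _ _
  (fun Z : plane R * measurableTypeR R => Z.1.1 + Z.2 * (v Z.1).1)
  (fun Z => Z.1.2 + Z.2 * (v Z.1).2)).
- apply: measurable_funD; first exact: (measurableT_comp measurable_fst mX).
  apply: measurable_funM => //; exact: (measurableT_comp mv1 mX).
- apply: measurable_funD; first exact: (measurableT_comp measurable_snd mX).
  apply: measurable_funM => //; exact: (measurableT_comp mv2 mX).
Qed.

Lemma measurable_flow {R : realType} {K : R} {v : R * R -> R * R} (s : R) :
  unit_lipschitz_field K v -> measurable_fun [set: plane R] (flow v s).
Proof.
move=> /measurable_flow2 mf.
exact: (measurableT_comp mf (pair2_measurable (s : measurableTypeR R))).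
Qed.

Lemma measurable_flow_line {R : realType} {K : R} {v : R * R -> R * R} X :
  unit_lipschitz_field K v ->
  measurable_fun [set: measurableTypeR R] (fun s : R => flow v s X).
Proof.
move=> /measurable_flow2 mf.
exact: (measurableT_comp mf (pair1_measurable (X : plane R))).
Qed.

(** Reverse triangle inequality: the displacements of [X] and [Y] differ by at most [T * K] times
    the distance between these points. *)
Lemma flow_expand {R : realType} {K T : R} {v : R * R -> R * R} {s : R}
    (X Y : R * R) :
  unit_lipschitz_field K v -> 0 < K -> `|s| <= T ->
  (1 - T * K) * euclid_norm (X - Y) <=
    euclid_norm ((flow v s X : R * R) - flow v s Y).
Proof.
move=> [_ vK] K0 sT.
have -> : (flow v s X : R * R) - flow v s Y = (X - Y) + s *: (v X - v Y).
  by rewrite /flow scalerBr opprD addrACA.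
have := ler_euclid_normD ((X - Y) + s *: (v X - v Y)) ((- s) *: (v X - v Y)).
rewrite scaleNr addrK -scaleNr euclid_normZ normrN => h.
have : `|s| * euclid_norm (v X - v Y) <= T * (K * euclid_norm (X - Y)).
  by rewrite ler_pM ?euclid_norm_ge0.
by move: h; rewrite mulrBl mul1r mulrA; lra.
Qed.

(** If distances grow at least by the factor [d], the preimage of a cell of side [q] fits in a
    square of side [4 * q / d], whose area is this multiple of [q^2]. *)
Definition distortion {R : realType} (d : R) : R := 16 / d ^+ 2.

Lemma lebesgue2_flow_cell {R : realType} {K T : R} {v : R * R -> R * R} {s : R}
    n k :
  unit_lipschitz_field K v -> 0 < K -> T < 1 / K -> `|s| <= T ->
  (lebesgue2 R (flow v s @^-1` dyadic_cell R n k) <=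
   (distortion (1 - T * K))%:E * lebesgue2 R (dyadic_cell R n k))%E.
Proof.
move=> vK K0 TK sT.
have d0 : 0 < 1 - T * K by rewrite subr_gt0 -ltr_pdivlMr.
set A := flow v s @^-1` _.
have [->|/set0P[X0 AX0]] := eqVneq A set0.
  by rewrite measure0 mule_ge0// lee_fin /distortion divr_ge0// sqr_ge0.
set q : R := (2 ^+ n)^-1.
have q0 : 0 < q by rewrite invr_gt0 exprn_gt0.
(* Two points of the cell are at Euclidean distance at most [2 * q], so their preimages are at
   distance at most [r]. The square [B] has half-side [r] and is centred at any point of the
   preimage. *)
pose r := 2 * q / (1 - T * K).
have r0 : 0 < r by rewrite divr_gt0// mulr_gt0.
pose B : set (plane R) := [set` `[X0.1 - r, X0.1 + r]] `*` [set` `[X0.2 - r, X0.2 + r]].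
have mB : measurable B by apply: measurableX; exact: measurable_itv.
apply: (@le_trans _ _ (lebesgue2 R B)).
  apply: le_measure; rewrite ?inE//.
    rewrite -[A]setTI; apply: (measurable_flow s vK) => //.
    exact: measurable_dyadic_cell.
  move=> X AX.
  have [h1 h2] : `|(flow v s X).1 - (flow v s X0).1| <= q /\
                 `|(flow v s X).2 - (flow v s X0).2| <= q.
    apply: dyadic_cell_close.
    by have /mem_dyadic_cell -> := AX; have /mem_dyadic_cell -> := AX0.
  have h3 := euclid_norm_ler ((flow v s X : R * R) - flow v s X0).
  have h4 := flow_expand X X0 vK K0 sT.
  have h5 : euclid_norm ((X : R * R) - X0) <= r.
    rewrite ler_pdivlMr// mulrC; apply: (le_trans h4); apply: (le_trans h3).
    by rewrite mulr_natl mulr2n lerD.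
  have := le_trans (ler_norm1_euclid _) h5; have := le_trans (ler_norm2_euclid _) h5.
  rewrite /B /= !in_itv /= !ler_norml; lra.
rewrite lebesgue2_dyadic_cell -/q.
rewrite lebesgue2_rect; [|exact: measurable_itv|exact: measurable_itv].
have aux (x : R) : lebesgue_measure [set` `[x - r, x + r]] = (2 * r)%:E.
  rewrite lebesgue_measure_itv/= lte_fin ltrBlDr -addrA ltrDl addr_gt0//.
  by rewrite -EFinB; congr EFin; lra.
rewrite !aux -!EFinM lee_fin /r /distortion le_eqVlt; apply/orP; left; apply/eqP.
field; exact: lt0r_neq0.
Qed.

(** * Exhaustion by boxes and comparison of measures *)

Definition box (R : realType) (N : nat) : set (plane R) :=
  [set` `[(- N%:R : R), N%:R[] `*` [set` `[(- N%:R : R), N%:R[].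

(** Integer corners and half-open sides make a box a union of unit cells, hence saturated at every
    scale. *)
Lemma dyadic_saturated_box {R : realType} N : dyadic_saturated 0 (box R N).
Proof.
have aux (x y : R) : Num.floor (2 ^+ 0 * x) = Num.floor (2 ^+ 0 * y) ->
    [set` `[(- N%:R : R), N%:R[] x -> [set` `[(- N%:R : R), N%:R[] y.
  rewrite expr0 !mul1r /= !in_itv /= => e.
  have -> : - N%:R = (- N%:Z)%:~R :> R by rewrite mulrNz.
  by rewrite -[N%:R]/(N%:Z%:~R) -!floor_ge_int -!floor_lt_int e.
by move=> [x1 x2] [y1 y2] [e1 e2] [h1 h2]; split; [exact: aux e1 h1|exact: aux e2 h2].
Qed.

Lemma measurable_box {R : realType} N : measurable (box R N).
Proof. exact: measurable_dyadic_saturated (@dyadic_saturated_box R N). Qed.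

Lemma box_nondecreasing {R : realType} {m n : nat} : (m <= n)%N ->
  box R m `<=` box R n.
Proof.
move=> mn X; rewrite /box /= !in_itv /=.
have : m%:R <= n%:R :> R by rewrite ler_nat.
by move=> ? [/andP[? ?] /andP[? ?]]; split; apply/andP; split; lra.
Qed.

Lemma bigcup_box {R : realType} : \bigcup_N box R N = setT.
Proof.
apply/seteqP; split => // -[x y] _.
have h : `|x| + `|y| < (Num.bound (`|x| + `|y|))%:R.
  by rewrite archi_boundP// addr_ge0.
exists (Num.bound (`|x| + `|y|)) => //; rewrite /box /= !in_itv /=.
have := ler_norm x; have := ler_norm (- x); have := ler_norm y; have := ler_norm (- y).
by rewrite !normrN => *; split; apply/andP; split; lra.
Qed.

Lemma lebesgue2_box_lty {R : realType} N : (lebesgue2 R (box R N) < +oo)%E.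
Proof.
rewrite lebesgue2_rect; [|exact: measurable_itv|exact: measurable_itv].
rewrite lebesgue_measure_itv /=.
by case: ifPn => _; rewrite -?EFinB -?EFinM ?mule0 ltry.
Qed.

(** Inside a box, replace [A] by a nearby dyadic set [E], compare the measures on [E] cell by cell,
    and go back to [A]; each replacement costs [e / 2]. *)
Lemma le_measure_dyadic {R : realType}
    {m1 m2 : {measure set (plane R) -> \bar R}} :
  (forall n k, (m1 (dyadic_cell R n k) <= m2 (dyadic_cell R n k))%E) ->
  (forall N, (m2 (box R N) < +oo)%E) ->
  forall A, measurable A -> (m1 A <= m2 A)%E.
Proof.
move=> m12 m2fin A mA.
have bounded N : (m1 (A `&` box R N) <= m2 (A `&` box R N))%E.
  have mB := @measurable_box R N.
  set B := box R N.
  (* Approximating with respect to the sum of the two measures gives one set [E] that is good for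
     both. *)
  pose mu : {measure set (plane R) -> \bar R} := mrestr (measure_add m1 m2) mB.
  have muE C : (mu C = m1 (C `&` B) + m2 (C `&` B))%E.
    by rewrite -measure_addE.
  have mufin : (mu setT < +oo)%E.
    rewrite muE setTI lte_add_pinfty//.
    (* The box is a union of unit cells, so [m1] inherits its finiteness there from [m2]. *)
    apply: le_lt_trans (m2fin N).
      apply: (le_measure_dyadic_saturated (m12 0%N)).
      exact: dyadic_saturated_box.
    exact: m2fin.
  apply/lee_addgt0Pr => e e0.
  have e20 : 0 < e / 2 by rewrite divr_gt0.
  have [n [E sE AE]] := (@dyadic_approximation R mu mufin A mA).2 _ e20.
  have mE := measurable_dyadic_saturated sE.
  have mAB : measurable (A `&` B) by exact: measurableI.
  have mEB : measurable (E `&` B) by exact: measurableI.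
  have mY : measurable (A `+` E) by apply: measurableU; exact: measurableD.
  have mYB : measurable ((A `+` E) `&` B) by exact: measurableI.
  have [Y1 Y2] : (m1 ((A `+` E) `&` B) <= (e / 2)%:E)%E /\
                 (m2 ((A `+` E) `&` B) <= (e / 2)%:E)%E.
    move/ltW: AE; rewrite muE => AE.
    by split; apply: le_trans AE; [exact: leeDl|exact: leeDr].
  have sub (m : {measure set (plane R) -> \bar R}) C D : measurable C ->
      measurable D -> C `<=` D `|` ((A `+` E) `&` B) ->
      (m C <= m D + m ((A `+` E) `&` B))%E.
    move=> mC mD CD; apply: le_trans (measureU2 m mD mYB).
    by apply: le_measure; rewrite ?inE//; exact: measurableU.
  rewrite [e]splitr EFinD addeA.
  apply: (@le_trans _ _ (m1 (E `&` B) + (e / 2)%:E)%E).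
    apply: le_trans (leeD2l _ Y1); apply: sub => //.
    by move=> X /= [AX BX]; have [EX|EX] := pselect (E X);
      [left|right; split => //; left].
  rewrite leeD2r//; apply: (@le_trans _ _ (m2 (E `&` B))).
    apply: (le_measure_dyadic_saturated (m12 n)).
    apply: dyadic_saturatedI => //.
    exact: (dyadic_saturatedS (leq0n n) (@dyadic_saturated_box R N)).
  apply: le_trans (leeD2l _ Y2); apply: sub => //.
  by move=> X /= [EX BX]; have [AX|AX] := pselect (A X); [left|right; split => //; right].
have AE : \bigcup_N (A `&` box R N) = A by rewrite -setI_bigcupr bigcup_box setIT.
have : m1 (A `&` box R N) @[N --> \oo] --> m1 A.
  rewrite -[in X in _ --> X]AE; apply: nondecreasing_cvg_mu.
  - by move=> N; apply: measurableI => //; exact: measurable_box.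
  - by rewrite AE.
  - move=> m n mn; apply/subsetPset => X [AX BX]; split=> //.
    exact: (box_nondecreasing mn).
move=> h; rewrite -(cvg_lim _ h)//.
apply: lime_le; first by apply/cvg_ex; eexists; exact: h.
near=> N; apply: (le_trans (bounded N)); apply: le_measure; rewrite ?inE//.
  by apply: measurableI => //; exact: measurable_box.
Unshelve. all: by end_near. Qed.

Section flow_estimates.
Context {R : realType} {K T : R} {v : R * R -> R * R}.
Hypotheses (vK : unit_lipschitz_field K v) (K0 : 0 < K) (TK : T < 1 / K).

Let C : R := distortion (1 - T * K).

Lemma distortion_ge0 (d : R) : 0 <= distortion d.
Proof. by rewrite /distortion divr_ge0// sqr_ge0. Qed.

Lemma lebesgue2_flow (s : R) (A : set (plane R)) : `|s| <= T -> measurable A ->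
  (lebesgue2 R (flow v s @^-1` A) <= C%:E * lebesgue2 R A)%E.
Proof.
move=> sT mA.
(* The canonical name builds the structure directly: unification does not find
   the measurability proof of a flow. *)
pose m1 := measure_function.measure_function_pushforward__canonical__measure_function_Measure
  (lebesgue2 R) (measurable_flow s vK).
pose m2 := mscale (NngNum (distortion_ge0 (1 - T * K))) (lebesgue2 R).
apply: (@le_measure_dyadic R m1 m2) => //.
- move=> n k; exact: (@lebesgue2_flow_cell R K T v s n k vK K0 TK sT).
- move=> N; rewrite /m2 /= /mscale lte_mul_pinfty//; last exact: lebesgue2_box_lty.
Qed.

(** One-sided substitute for a change of variables: the left side is an integral against the
    push-forward of Lebesgue measure, which is at most [C] times that measure. *)
Lemma ge0_integral_flow (s : R) (f : plane R -> \bar R) : `|s| <= T ->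
  measurable_fun setT f -> (forall X, 0 <= f X)%E ->
  (\int[lebesgue2 R]_X f (flow v s X) <= C%:E * \int[lebesgue2 R]_X f X)%E.
Proof.
move=> sT mf f0.
pose m1 := measure_function.measure_function_pushforward__canonical__measure_function_Measure
  (lebesgue2 R) (measurable_flow s vK).
rewrite -[C%:E]/((NngNum (distortion_ge0 (1 - T * K)))%:num%:E).
rewrite -ge0_integral_mscale//.
have := @ge0_integral_pushforward _ _ _ _ _ _ (measurable_flow s vK)
  (lebesgue2 R) setT f measurableT mf.
rewrite preimage_setT => <-//.
apply: ge0_le_measure_integral => //.
  exact: (measurable_flow s vK).
by move=> ? A mA; exact: (lebesgue2_flow s A sT mA).
Qed.

End flow_estimates.

(** * Tonelli along the segments of the field *)

Notation centered t := [set` `[(- t)%R, t%R]].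

Lemma lebesgue_measure_centered {R : realType} {t : R} : 0 <= t ->
  @lebesgue_measure R (centered t) = (2 * t)%:E.
Proof.
rewrite le_eqVlt => /predU1P[<-|t0].
  by rewrite oppr0 set_itv1 lebesgue_measure_set1 mulr0.
by rewrite lebesgue_measure_itv/= lte_fin gtrN// -EFinB; congr EFin; lra.
Qed.

Lemma sigma_finite_lebesgue2 {R : realType} : sigma_finite setT (lebesgue2 R).
Proof.
exists (box R); first by rewrite bigcup_box.
by move=> N; split; [exact: measurable_box|exact: lebesgue2_box_lty].
Qed.

Section flow_tonelli.
Context {R : realType} {K T : R} {v : R * R -> R * R}.
Hypotheses (vK : unit_lipschitz_field K v) (K0 : 0 < K) (TK : T < 1 / K).

Let C : R := distortion (1 - T * K).

(** Extension by zero off the strip of times in [[-t, t]], so that Tonelli is applied on the full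
    product space. *)
Let patch_flow (t : R) (f : plane R -> \bar R) :
    plane R * measurableTypeR R -> \bar R :=
  (fun Z => f (flow v Z.2 Z.1)) \_ (setT `*` (centered t)).

Let patch_flowE t f X s :
  patch_flow t f (X, s) = ((fun s : R => f (flow v s X)) \_ (centered t)) s.
Proof.
rewrite /patch_flow !patchE; congr (if _ then _ else _).
by apply/idP/idP; rewrite !inE => // -[].
Qed.

Let measurable_patch_flow t f : measurable_fun setT f ->
  measurable_fun setT (patch_flow t f).
Proof.
move=> mf; have mI : measurable ([set: plane R] `*` (centered t)).
  by apply: measurableX => //; exact: measurable_itv.
apply/(measurable_restrictT _ mI)/measurable_funTS.
exact: (measurableT_comp mf (measurable_flow2 vK)).
Qed.

Let integral_patch_flow (t : R) f X :
  (\int[lebesgue_measure]_(s in (centered t)) f (flow v s X) =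
   \int[lebesgue_measure]_s patch_flow t f (X, s))%E.
Proof. by rewrite integral_mkcond; apply: eq_integral => s _; rewrite patch_flowE. Qed.

Lemma measurable_line_integral (t : R) (f : plane R -> \bar R) :
  measurable_fun setT f -> (forall X, 0 <= f X)%E ->
  measurable_fun setT (fun X =>
    \int[lebesgue_measure]_(s in (centered t)) f (flow v s X))%E.
Proof.
move=> mf f0; under eq_fun do rewrite integral_patch_flow.
apply: (measurable_fun_fubini_tonelli_F (patch_flow t f)).
  exact: measurable_patch_flow.
by move=> Z; rewrite /patch_flow patchE; case: ifPn.
Qed.

(** After exchanging the integrals, each time [s] contributes at most [C] times the integral of [f],
    and the times fill an interval of length [2 * t]. *)
Lemma ge0_integral_flow_line (t : R) (f : plane R -> \bar R) : 0 <= t -> t <= T ->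
  measurable_fun setT f -> (forall X, 0 <= f X)%E ->
  (\int[lebesgue2 R]_X
     \int[lebesgue_measure]_(s in (centered t)) f (flow v s X) <=
   (C * (2 * t))%:E * \int[lebesgue2 R]_X f X)%E.
Proof.
move=> t0 tT mf f0.
have g0 Z : (0 <= patch_flow t f Z)%E.
  by rewrite /patch_flow patchE; case: ifPn.
under eq_integral do rewrite integral_patch_flow.
have mg := measurable_patch_flow t f mf.
(* For a product measure the instance of sigma-finiteness that is found by
   inference is the one of products of subprobabilities. *)
pose sf2 : {sigma_finite_measure set (plane R) -> \bar R} :=
  HB.pack (Measure.sort (lebesgue2 R))
    (Measure_isSigmaFinite.Build _ _ _ (lebesgue2 R) sigma_finite_lebesgue2).
have /= tonelli := @fubini_tonelli _ _ _ _ R sf2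
  (@lebesgue_measure R) _ mg g0.
rewrite [leLHS]tonelli.
apply: (@le_trans _ _ (\int[lebesgue_measure]_(s in (centered t))
    (C%:E * \int[lebesgue2 R]_X f X))%E).
  rewrite [leRHS]integral_mkcond; apply: ge0_le_integral => //.
  - by move=> s _; apply: integral_ge0.
  - exact: (@measurable_fun_fubini_tonelli_G _ _ _ _ R
      sf2 _ mg g0).
  - have mI : measurable (centered t : set (measurableTypeR R)) by exact: measurable_itv.
    apply/(measurable_restrictT _ mI); exact: measurable_cst.
  - move=> s _; rewrite patchE; case: ifPn => sI.
      have st : `|s| <= T.
        by move: sI; rewrite inE /= in_itv /= -ler_norml => /le_trans; apply.
      apply: le_trans (ge0_integral_flow vK K0 TK s f st mf f0).
      rewrite le_eqVlt; apply/orP; left; apply/eqP; apply: eq_integral => X _.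
      by rewrite patch_flowE patchE sI.
    by rewrite integral0_eq// => X _; rewrite patch_flowE patchE (negbTE sI).
rewrite integral_cst//.
by rewrite [X in (_ * X)%E]lebesgue_measure_centered// muleAC -EFinM.
Qed.

End flow_tonelli.

(** * Jensen's inequality for averages over an interval *)

(** Up to the factor [r], this says that the graph of [a |-> a^r] lies above its tangent at [m]. It
    is Young's inequality for [a] and [m^(r-1)]; at [r = 1] the conjugate exponent degenerates and
    both sides equal [a]. *)
Lemma young_powR {R : realType} (a m r : R) : 0 <= a -> 0 <= m -> 1 <= r ->
  m `^ (r - 1) * a <= r^-1 * a `^ r + (1 - r^-1) * m `^ r.
Proof.
move=> a0 m0; rewrite le_eqVlt => /predU1P[<-|r1].
  by rewrite subrr powRr0 invr1 subrr mul0r addr0 !mul1r powRr1.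
have r0 : 0 < r by rewrite (lt_trans ltr01).
have r10 : 0 < r - 1 by rewrite subr_gt0.
have q0 : 0 < r / (r - 1) by rewrite divr_gt0.
have qV : (r / (r - 1))^-1 = 1 - r^-1.
  by field; rewrite !lt0r_neq0.
have := @conjugate_powR _ a (m `^ (r - 1)) r (r / (r - 1)) a0 (powR_ge0 _ _) r0 q0.
rewrite qV addrC subrK => /(_ erefl).
by rewrite -powRrM mulrCA divff ?lt0r_neq0// mulr1 mulrC [_ / r]mulrC [_ * (1 - _)]mulrC.
Qed.

(** This puts [L^r] inside [L^1] on bounded intervals. *)
Lemma ler_1DpowR {R : realType} (a r : R) : 0 <= a -> 1 <= r -> a <= 1 + a `^ r.
Proof.
move=> a0 r1; have [a1|/ltW a1] := leP a 1.
  by rewrite (le_trans a1)// lerDl powR_ge0.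
by rewrite ler_wpDl// le1r_powR.
Qed.

Lemma measurable_normr_powR {d} {X : measurableType d} {R : realType}
    (D : set X) (F : X -> R) (r : R) :
  measurable_fun D F -> measurable_fun D (fun x => (`|F x| `^ r)%:E).
Proof.
move=> mF; apply/measurable_EFinP.
apply: (measurableT_comp (measurable_powR r)).
exact: measurableT_comp.
Qed.

Lemma Lnorm_powR {d} {X : measurableType d} {R : realType}
    (mu : {measure set X -> \bar R}) (F : X -> R) (r : R) : r != 0 ->
  ('N[mu]_r%:E[EFin \o F] `^ r = \int[mu]_x (`|F x| `^ r)%:E)%E.
Proof. by move=> r0; rewrite poweR_Lnorm//; apply: eq_integral => x _. Qed.

Section centered_average.
Context {R : realType}.
Notation leb := (@lebesgue_measure R).

Lemma measurable_centered (t : R) :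
  measurable (centered t : set (measurableTypeR R)).
Proof. exact: measurable_itv. Qed.

Lemma integrable_centered_cst (t c : R) : 0 <= t ->
  leb.-integrable (centered t) (EFin \o cst c).
Proof.
move=> t0; apply/integrableP; split; first by apply/measurable_EFinP.
rewrite (eq_integral (cst `|c|%:E))// integral_cst; last exact: measurable_centered.
by rewrite [X in (_ * X)%E]lebesgue_measure_centered// -EFinM ltry.
Qed.

Lemma integrable_centered_powR (t r : R) (g : R -> R) : 0 <= t -> 1 <= r ->
  measurable_fun setT g ->
  (\int[leb]_(s in centered t) (`|g s| `^ r)%:E < +oo)%E ->
  leb.-integrable (centered t) (fun s => (`|g s| `^ r)%:E) /\
  leb.-integrable (centered t) (EFin \o g).
Proof.
move=> t0 r1 mg gfin.
have mI := measurable_centered t.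
have mgr : measurable_fun (centered t) (fun s => (`|g s| `^ r)%:E).
  by apply: measurable_normr_powR; exact: measurable_funTS.
have igr : leb.-integrable (centered t) (fun s => (`|g s| `^ r)%:E).
  apply/integrableP; split => //.
  by under eq_integral do rewrite gee0_abs ?lee_fin ?powR_ge0//.
split => //.
apply: (@le_integrable _ _ _ leb _ mI _
  (fun s => ((EFin \o cst 1%R) s + (`|g s| `^ r)%:E)%E)).
- by apply/measurable_EFinP; exact: measurable_funTS.
- move=> s _ /=; rewrite lee_fin.
  by rewrite [leRHS]ger0_norm ?ler_1DpowR// addr_ge0// powR_ge0.
- by apply: integrableD => //; exact: integrable_centered_cst.
Qed.

(** Integrate [young_powR] over the interval with [m] the mean of [|g|]. The integral of [|g|] is
    [2 * t * m], so the terms in [m^r] combine and leave [r^-1 * 2 * t * m^r] on the left. *)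
Lemma jensen_average (t r : R) (g : R -> R) : 0 < t -> 1 <= r ->
  measurable_fun setT g ->
  ((`|(2 * t)^-1 * \int[leb]_(s in centered t) g s| `^ r)%:E <=
   ((2 * t)^-1)%:E * \int[leb]_(s in centered t) (`|g s| `^ r)%:E)%E.
Proof.
move=> t0 r1 mg.
have mI := measurable_centered t.
have t20 : 0 < (2 * t)^-1 by rewrite invr_gt0 mulr_gt0.
have r0 : 0 < r by rewrite (lt_le_trans ltr01).
(* If the right side is infinite there is nothing to prove; otherwise [g] is integrable on the
   interval. *)
have [gfin|] := ltP (\int[leb]_(s in centered t) (`|g s| `^ r)%:E)%E +oo%E; last first.
  by rewrite leye_eq => /eqP ->; rewrite gt0_muley ?leey// lte_fin.
have [igr ig] := integrable_centered_powR t r g (ltW t0) r1 mg gfin.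
have inorm : leb.-integrable (centered t) (EFin \o (fun s => `|g s|)).
  exact: integrable_norm.
set A := (\int[leb]_(s in centered t) (`|g s| `^ r)%:E)%E.
have AE : A = (\int[leb]_(s in centered t) (`|g s| `^ r))%:E.
  by rewrite /Rintegral fineK//; exact: integrable_fin_num.
rewrite AE -EFinM lee_fin.
set I1 := \int[leb]_(s in centered t) `|g s|.
pose m := (2 * t)^-1 * I1.
have I10 : 0 <= I1 by apply: Rintegral_ge0.
have m0 : 0 <= m by rewrite mulr_ge0// ltW.
apply: (@le_trans _ _ (m `^ r)).
  apply: ge0_ler_powR; rewrite ?nnegrE ?(ltW r0)//.
  by rewrite normrM (gtr0_norm t20) ler_wpM2l ?(ltW t20)// le_normr_Rintegral.
have : m `^ (r - 1) * I1 <=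
   r^-1 * \int[leb]_(s in centered t) (`|g s| `^ r) + (1 - r^-1) * m `^ r * (2 * t).
  have -> : (1 - r^-1) * m `^ r * (2 * t) =
      \int[leb]_(s in centered t) cst ((1 - r^-1) * m `^ r) s.
    by rewrite Rintegral_cst//= [X in fine X]lebesgue_measure_centered ?(ltW t0).
  rewrite -!RintegralZl// -RintegralD//.
  - apply: le_Rintegral => //.
    + exact: (integrableZl mI (m `^ (r - 1)) inorm).
    + exact: (integrableD mI (integrableZl mI r^-1 igr)
        (integrable_centered_cst t ((1 - r^-1) * m `^ r) (ltW t0))).
    + by move=> s _; exact: young_powR.
  - exact: (integrableZl mI r^-1 igr).
  - exact: (integrable_centered_cst t ((1 - r^-1) * m `^ r) (ltW t0)).
have I1E : I1 = (2 * t) * m by rewrite /m mulrA divff ?mul1r// mulf_neq0// gt_eqF.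
rewrite {1}I1E mulrCA [_ `^ (r-1) * m]mulrC mulr_powRB1// => h.
rewrite ler_pdivlMl ?mulr_gt0//.
have rV0 : 0 < r^-1 by rewrite invr_gt0.
rewrite -(ler_pM2l rV0); move: h.
by set A' := \int[leb]_(s in _) _; set M := m `^ r; lra.
Qed.

End centered_average.

(** * Measurability and norm bounds for line averages *)

Lemma line_averageE {R : realType} (v : R * R -> R * R) (t : R)
    (F : R * R -> R) : t != 0 ->
  line_average v t F = fun X => (2 * `|t|)^-1 *
    \int[@lebesgue_measure R]_(s in centered `|t|) F (flow v s X).
Proof.
move=> t0; apply/funext => X; rewrite /line_average /oriented_Rintegral.
have [tlt|tgt|t00] := ltgtP t 0; last by rewrite t00 eqxx in t0.
- rewrite ltr0_norm// ifF; last by apply/negP; rewrite leNgt => /negP; apply; lra.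
  (* For [t < 0] the prefactor and the oriented integral both change sign. *)
  by rewrite opprK !mulrN invrN mulNr.
- by rewrite gtr0_norm// ifT//; lra.
Qed.

Section line_average_estimates.
Context {R : realType} {K T : R} {v : R * R -> R * R}.
Hypotheses (vK : unit_lipschitz_field K v) (K0 : 0 < K) (TK : T < 1 / K).
Notation leb := (@lebesgue_measure R).
Notation leb2 := (lebesgue2 R).

Let C : R := distortion (1 - T * K).

Lemma measurable_line_average (t : R) (F : plane R -> R) : t != 0 ->
  measurable_fun setT F ->
  measurable_fun setT (line_average v t F : plane R -> R).
Proof.
move=> t0 mF; rewrite line_averageE//.
apply: measurable_funM; first exact: measurable_cst.
apply: (@measurableT_comp _ _ _ _ _ _ (@fine R)).
  by [].
have mE : measurable_fun setT (EFin \o F) by exact/measurable_EFinP.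
have mP := measurable_line_integral vK `|t| _ (measurable_funepos mE)
  (fun X => funepos_ge0 _ X).
have mN := measurable_line_integral vK `|t| _ (measurable_funeneg mE)
  (fun X => funeneg_ge0 _ X).
apply: eq_measurable_fun (emeasurable_funB mP mN) => X _.
rewrite /= [RHS]integralE; congr (_ - _)%E; apply: eq_integral => s _.
- by rewrite !funeposE.
- by rewrite !funenegE.
Qed.

Lemma integral_line_average_powR (t r : R) (F : plane R -> R) :
  0 < `|t| -> `|t| <= T -> 1 <= r -> measurable_fun setT F ->
  (\int[leb2]_X (`|line_average v t F X| `^ r)%:E <=
   C%:E * \int[leb2]_X (`|F X| `^ r)%:E)%E.
Proof.
move=> t0 tT r1 mF; have tn0 : t != 0 by rewrite -normr_gt0.
have mFr : measurable_fun setT (fun X => (`|F X| `^ r)%:E).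
  exact: measurable_normr_powR.
have Fr0 X : (0 <= (`|F X| `^ r)%:E)%E by rewrite lee_fin powR_ge0.
have mline := measurable_line_integral vK `|t| _ mFr Fr0.
have t20 : 0 < (2 * `|t|)^-1 by rewrite invr_gt0 mulr_gt0.
apply: (@le_trans _ _ (\int[leb2]_X (((2 * `|t|)^-1)%:E *
    \int[leb]_(s in centered `|t|) (`|F (flow v s X)| `^ r)%:E))%E).
  apply: ge0_le_integral => //.
  - apply: measurable_normr_powR; exact: measurable_line_average.
  - exact: measurable_funeM.
  - move=> X _; rewrite line_averageE//; apply: jensen_average => //.
    exact: (measurableT_comp mF (measurable_flow_line X vK)).
rewrite ge0_integralZl_EFin ?(ltW t20)//; last by move=> X _; exact: integral_ge0.
have := ge0_integral_flow_line vK K0 TK `|t| _ (normr_ge0 t) tT mFr Fr0.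
rewrite -(@lee_pmul2l _ ((2 * `|t|)^-1)%:E) ?lte_fin//.
(* The length [2 * |t|] produced by Tonelli cancels the normalization, which makes the bound
   independent of [t]. *)
move=> /le_trans; apply; rewrite muleA -EFinM.
by rewrite mulrCA mulVf ?mulr1// mulf_neq0// gt_eqF.
Qed.

Lemma Lnorm_line_average (t r : R) (F : plane R -> R) :
  0 < `|t| -> `|t| <= T -> 1 <= r -> measurable_fun setT F ->
  ('N[leb2]_r%:E[EFin \o line_average v t F] <=
   (C `^ r^-1)%:E * 'N[leb2]_r%:E[EFin \o F])%E.
Proof.
move=> t0 tT r1 mF; have r0 : 0 < r by rewrite (lt_le_trans ltr01).
have h := integral_line_average_powR t r F t0 tT r1 mF.
rewrite unlock /=.
have C0 : 0 <= C by exact: distortion_ge0.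
rewrite -poweR_EFin -poweRM ?lee_fin//; last by apply: integral_ge0.
apply: gt0_ler_poweR => //; rewrite ?in_itv/= ?leey ?andbT.
- by rewrite invr_ge0 ltW.
- exact: integral_ge0.
- by rewrite mule_ge0// integral_ge0.

Qed.

(** Tonelli's bound for the indicator of [N]: the time that a segment spends in [N] has integral 0
    over all starting points. *)
Lemma ae_flow_line_null (t : R) (N : set (plane R)) : 0 <= t -> t <= T ->
  measurable N -> leb2 N = 0%E ->
  \forall X \ae leb2, leb ([set s | N (flow v s X)] `&` centered t) = 0%E.
Proof.
move=> t0 tT mN N0.
have mf : measurable_fun setT (fun X => (\1_N X)%:E : \bar R).
  by apply/measurable_EFinP.
have f0 X : (0 <= (\1_N X)%:E :> \bar R)%E by rewrite lee_fin.
have := ge0_integral_flow_line vK K0 TK t _ t0 tT mf f0.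
rewrite integral_indic// setIT N0 mule0 => le0.
have : (\int[leb2]_X `|\int[leb]_(s in centered t) (\1_N (flow v s X))%:E| = 0)%E.
  apply/eqP; rewrite eq_le integral_ge0// andbT.
  by under eq_integral do rewrite gee0_abs ?integral_ge0//.
have mg := measurable_line_integral vK t _ mf f0.
move=> /(ae_eq_integral_abs leb2 measurableT mg).
apply: filterS => X /= /(_ I) <-.
have mS : measurable [set s : measurableTypeR R | N (flow v s X)].
  by rewrite -[X in measurable X]setTI; exact: (measurable_flow_line X vK).
rewrite -(integral_indic leb (measurable_centered t) mS).
by apply: eq_integral => s _; rewrite /= !indicE.
Qed.

End line_average_estimates.

(** * Line averages on L^p *)

Section integral_off_null_set.
Local Open Scope ereal_scope.
Context {d} {X : measurableType d} {R : realType}.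
Variables (mu : {measure set X -> \bar R}) (N : set X).
Hypotheses (mN : measurable N) (N0 : mu N = 0).
Import HBNNSimple.

(** The integral of a nonnegative function is a supremum over simple functions below it. A simple
    function below [f], set to 0 on [N], lies below [g] and keeps its integral, whether or not [f]
    and [g] are measurable. *)
Let ge0_le_integral_off_null (f g : X -> \bar R) :
  (forall x, 0 <= f x) -> (forall x, 0 <= g x) ->
  (forall x, ~ N x -> f x <= g x) -> \int[mu]_x f x <= \int[mu]_x g x.
Proof.
move=> f0 g0 fg; rewrite !ge0_integralTE//= ge_ereal_sup// => _ [h/= hf] <-.
apply: le_ereal_sup_tmp.
exists (sintegral mu (proj_nnsfun h (measurableC mN))).
  exists (proj_nnsfun h (measurableC mN)) => // x.
  rewrite /= /mindic indicE; case: (boolP (x \in ~` N)) => [|_].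
    by rewrite inE => Nx; rewrite mulr1 (le_trans (hf x))// fg.
  by rewrite mulr0.
rewrite -!integralT_nnsfun; apply: ae_ge0_le_integral => //.
- by move=> x _; rewrite lee_fin.
- exact/measurable_EFinP.
- by move=> x _; rewrite lee_fin.
- exact/measurable_EFinP.
exists N; split => // x /= /not_implyP[_]; apply: contra_notP => Nx.
by rewrite /mindic indicE mem_set// mulr1.
Qed.

(* The function [G] of the theorem need not be measurable, which rules out
   [ae_eq_integral]. *)
Lemma eq_integral_off_null (D : set X) (f g : X -> \bar R) :
  (forall x, D x -> ~ N x -> f x = g x) ->
  \int[mu]_(x in D) f x = \int[mu]_(x in D) g x.
Proof.
move=> fg; rewrite !(integral_mkcond D) [LHS]integralE [RHS]integralE.
have fgD x : ~ N x -> (f \_ D) x = (g \_ D) x.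
  by move=> Nx; rewrite !patchE; case: ifPn => //; rewrite inE => Dx; exact: fg.
congr (_ - _); apply/eqP; rewrite eq_le; apply/andP; split;
  by apply: ge0_le_integral_off_null => // x /fgD; rewrite ?funeposE ?funenegE => ->.
Qed.

End integral_off_null_set.

Lemma in_LfunP {d} {X : measurableType d} {R : realType}
    (mu : {measure set X -> \bar R}) (p : \bar R) (F : X -> R) :
  F \in Lfun mu p <->
  measurable_fun setT F /\ ('N[mu]_p[EFin \o F] < +oo)%E.
Proof.
by split=> [/andP[]|[mF nF]]; rewrite ?inE//; apply/andP; split; rewrite inE.
Qed.

Lemma Lnorm_infty_ltyP {d} {X : measurableType d} {R : realType}
    (mu : {measure set X -> \bar R}) (F : X -> R) :
  ('N[mu]_+oo[EFin \o F] < +oo)%E <->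
  exists M, \forall x \ae mu, `|F x| <= M.
Proof.
rewrite unlock; case: ifPn => [_|]; last first.
  (* On a space of measure 0 the norm is 0 by convention, and any bound holds almost everywhere. *)
  rewrite -leNgt => mu0; split => // _; exists 0.
  exists setT; split => //; apply/eqP; rewrite eq_le measure_ge0 andbT//.
split=> [|[M FM]].
  exact: (@ess_supr_bounded _ _ _ mu (fun x => `|F x|)).
apply: (@le_lt_trans _ _ M%:E); last by rewrite ltry.
by apply/ess_supP; apply: filterS FM => x; rewrite /= lee_fin.
Qed.

Section line_average_Lfun.
Context {R : realType} {K T : R} {v : R * R -> R * R}.
Hypotheses (vK : unit_lipschitz_field K v) (K0 : 0 < K) (TK : T < 1 / K).
Notation leb := (@lebesgue_measure R).
Notation leb2 := (lebesgue2 R).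

(** Transfers a property from almost every point to almost every time on almost every segment. The
    exceptional times are given as an explicit null set, the form used by [eq_integral_off_null]. *)
Lemma ae_flow_line (t : R) (P : plane R -> Prop) : 0 <= t -> t <= T ->
  (\forall X \ae leb2, P X) ->
  \forall X \ae leb2, exists2 N : set (measurableTypeR R),
    measurable N /\ leb N = 0%E &
    forall s, centered t s -> ~ N s -> P (flow v s X).
Proof.
move=> t0 tT [N [mN N0 NP]].
apply: filterS (ae_flow_line_null vK K0 TK t N t0 tT mN N0) => X NX.
exists ([set s | N (flow v s X)] `&` centered t).
  split => //; apply: measurableI; last exact: measurable_centered.
  by rewrite -[X in measurable X]setTI; exact: (measurable_flow_line X vK).
move=> s st Ns; apply: contrapT => nP; apply: Ns; split => //.
exact: NP.
Qed.

Lemma ae_line_integral_lty (t r : R) (F : plane R -> R) :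
  0 <= t -> t <= T -> 0 < r -> measurable_fun setT F ->
  ('N[leb2]_r%:E[EFin \o F] < +oo)%E ->
  \forall X \ae leb2,
    (\int[leb]_(s in centered t) (`|F (flow v s X)| `^ r)%:E < +oo)%E.
Proof.
move=> t0 tT r0 mF /(fun h => @poweR_lty _ _ r h).
rewrite Lnorm_powR ?gt_eqF// => Ffin.
have mFr : measurable_fun setT (fun X => (`|F X| `^ r)%:E).
  exact: measurable_normr_powR.
have Fr0 X : (0 <= (`|F X| `^ r)%:E)%E by rewrite lee_fin powR_ge0.
have mg := measurable_line_integral vK t _ mFr Fr0.
have : leb2.-integrable setT (fun X =>
    \int[leb]_(s in centered t) (`|F (flow v s X)| `^ r)%:E)%E.
  apply/integrableP; split; first exact: mg.
  under eq_integral do rewrite gee0_abs ?integral_ge0//.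
  apply: le_lt_trans (ge0_integral_flow_line vK K0 TK t _ t0 tT mFr Fr0) _.
  by rewrite lte_mul_pinfty// lee_fin mulr_ge0 ?distortion_ge0 ?mulr_ge0.
move=> /(integrable_ae measurableT); apply: filterS => X /= /(_ I).
by rewrite ge0_fin_numE// integral_ge0.
Qed.

(** The power 1 lets the lemmas about finite exponents serve the case [p = +oo] too. *)
Lemma ae_line_integral_bounded (t : R) (F : plane R -> R) :
  0 <= t -> t <= T -> measurable_fun setT F ->
  ('N[leb2]_+oo[EFin \o F] < +oo)%E ->
  exists M, \forall X \ae leb2,
    (\int[leb]_(s in centered t) (`|F (flow v s X)| `^ 1)%:E <=
     (M * (2 * t))%:E)%E.
Proof.
move=> t0 tT mF /Lnorm_infty_ltyP[M FM]; exists `|M|.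
apply: filterS (ae_flow_line t _ t0 tT FM) => X [N [mN N0] NM].
apply: (@le_trans _ _ (\int[leb]_(s in centered t) `|M|%:E)%E); last first.
  rewrite integral_cst; last exact: measurable_centered.
  by rewrite [X in (_ * X)%E]lebesgue_measure_centered.
apply: ae_ge0_le_integral => //.
- by apply: measurable_normr_powR; apply: measurable_funTS;
    exact: (measurableT_comp mF (measurable_flow_line X vK)).
exists N; split => // s /= /not_implyP[st]; apply: contra_notP => Ns.
by rewrite lee_fin powRr1// (le_trans (NM _ st Ns))// ler_norm.
Qed.

(** At these points the average is a genuine integral rather than a value fixed by convention, and
    averaging is additive there. *)
Lemma ae_line_integrable (t : R) (p : \bar R) (F : plane R -> R) :
  0 <= t -> t <= T -> (1 <= p)%E -> F \in Lfun leb2 p ->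
  \forall X \ae leb2,
    leb.-integrable (centered t) (fun s : R => (F (flow v s X))%:E).
Proof.
move=> t0 tT p1 /in_LfunP[mF]; case: p p1 => [r| |]//; last move=> _.
- rewrite lee_fin => r1 nF; have r0 : 0 < r by rewrite (lt_le_trans ltr01).
  apply: filterS (ae_line_integral_lty t r F t0 tT r0 mF nF) => X.
  by case/(integrable_centered_powR t r _ t0 r1
    (measurableT_comp mF (measurable_flow_line X vK))).
- move=> nF.
  have [M] := ae_line_integral_bounded t F t0 tT mF nF.
  apply: filterS => X /le_lt_trans/(_ (ltry _)).
  by case/(integrable_centered_powR t 1 _ t0 (lexx _)
    (measurableT_comp mF (measurable_flow_line X vK))).
Qed.

Lemma line_average_Lfun (t : R) (p : \bar R) (F : plane R -> R) :
  0 < `|t| -> `|t| <= T -> (1 <= p)%E -> F \in Lfun leb2 p ->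
  line_average v t F \in Lfun leb2 p.
Proof.
move=> t0 tT p1 /in_LfunP[mF nF]; have tn0 : t != 0 by rewrite -normr_gt0.
apply/in_LfunP; split; first exact: measurable_line_average vK t F tn0 mF.
case: p p1 nF => [r| |]//; last move=> _.
- rewrite lee_fin => r1 nF.
  apply: le_lt_trans (Lnorm_line_average vK K0 TK t r F t0 tT r1 mF) _.
  by rewrite lte_mul_pinfty// lee_fin powR_ge0.
- move=> nF; apply/Lnorm_infty_ltyP.
  have [M FM] := ae_line_integral_bounded `|t| F (ltW t0) tT mF nF.
  exists M; apply: filterS FM => X FM; rewrite line_averageE// -lee_fin.
  have := jensen_average `|t| 1 _ t0 (lexx _)
    (measurableT_comp mF (measurable_flow_line X vK)).
  rewrite powRr1// => /le_trans; apply.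
  have t20 : 0 < (2 * `|t|)^-1 by rewrite invr_gt0 mulr_gt0.
  move: FM; rewrite -(@lee_pmul2l _ ((2 * `|t|)^-1)%:E) ?lte_fin//.
  move=> /le_trans; apply; rewrite -EFinM lee_fin mulrCA mulVf ?mulr1//.
  by rewrite mulf_neq0// gt_eqF.
Qed.

Lemma line_average_ae_eq (t : R) (F G : plane R -> R) :
  0 < `|t| -> `|t| <= T -> F = G %[ae leb2] ->
  line_average v t F = line_average v t G %[ae leb2].
Proof.
move=> t0 tT FG; have tn0 : t != 0 by rewrite -normr_gt0.
apply: filterS (ae_flow_line `|t| _ (ltW t0) tT FG) => X [N [mN N0] NFG] _.
rewrite !line_averageE//; congr (_ * fine _).
by apply: (eq_integral_off_null leb N mN N0) => s st Ns; rewrite NFG.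
Qed.

End line_average_Lfun.

(** * Density of dyadic step functions *)

Lemma Lnorm_le {d} {X : measurableType d} {R : realType}
    (mu : {measure set X -> \bar R}) (F : X -> R) (r e : R) :
  0 < r -> 0 <= e -> (\int[mu]_x (`|F x| `^ r)%:E <= (e `^ r)%:E)%E ->
  ('N[mu]_r%:E[EFin \o F] <= e%:E)%E.
Proof.
move=> r0 e0 h; rewrite unlock /=.
have -> : e%:E = ((e `^ r)%:E `^ r^-1)%E.
  by rewrite poweR_EFin -powRrM mulfV ?gt_eqF// powRr1.
apply: gt0_ler_poweR => //; rewrite ?in_itv/= ?leey ?andbT.
- by rewrite invr_ge0 ltW.
- exact: integral_ge0.
- by rewrite lee_fin powR_ge0.
Qed.

Lemma cvg_normr_powR {R : realType} (u : nat -> R) (r : R) : 0 < r ->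
  u n @[n --> \oo] --> 0 -> (`|u n| `^ r)%:E @[n --> \oo] --> 0%E.
Proof.
move=> r0 u0; apply: cvg_EFin; first by near=> n.
apply/cvgrPdist_le => e e0.
have e'0 : 0 < e `^ r^-1 by rewrite powR_gt0.
move/cvgrPdist_le : u0 => /(_ _ e'0); apply: filterS => n.
rewrite !sub0r !normrN => h; rewrite ger0_norm ?powR_ge0//.
have -> : e = (e `^ r^-1) `^ r by rewrite -powRrM mulVf ?gt_eqF// powRr1// ltW.
by apply: ge0_ler_powR; rewrite ?nnegrE ?powR_ge0// ltW.
Unshelve. all: by end_near. Qed.

(** Finite combinations of cell indicators, described without listing coefficients: a sum is handled
    by the larger scale, the larger box and the sum of the bounds. *)
Definition dyadic_step {R : realType} (H : plane R -> R) :=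
  exists n N B, [/\ forall X Y, dyadic_index n X = dyadic_index n Y -> H X = H Y,
    forall X, `|H X| <= B & forall X, ~ box R N X -> H X = 0].

Lemma measurable_dyadic_step {R : realType} (H : plane R -> R) :
  dyadic_step H -> measurable_fun setT H.
Proof.
move=> [n [N [B [sH _ _]]]] _ Y _; rewrite setTI.
by apply: (@measurable_dyadic_saturated _ n) => X X' /sH /= ->.
Qed.

Lemma integral_powR_dyadic_step_lty {R : realType} (H : plane R -> R) (r : R) :
  0 < r -> dyadic_step H ->
  (\int[lebesgue2 R]_X (`|H X| `^ r)%:E < +oo)%E.
Proof.
move=> r0 sH; have mH := measurable_dyadic_step H sH.
move: sH => [n [N [B [_ HB H0]]]].
apply: (@le_lt_trans _ _ (\int[lebesgue2 R]_X ((B `^ r)%:E * (\1_(box R N) X)%:E)))%E.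
  apply: ge0_le_integral => //.
  - exact: measurable_normr_powR.
  - apply/measurable_EFinP; apply: measurable_funM => //.
    exact: measurable_indic (measurable_box N).
  - move=> X _; rewrite -EFinM lee_fin indicE; case: (boolP (X \in box R N)) => [_|].
      rewrite mulr1 ge0_ler_powR ?nnegrE ?(ltW r0)//.
      exact: le_trans (HB X).
    by rewrite notin_setE => /H0 ->; rewrite normr0 powR0 ?gt_eqF// mulr0.
rewrite ge0_integralZl_EFin ?powR_ge0//; last first.
  by apply/measurable_EFinP; exact: measurable_indic (measurable_box N).
rewrite integral_indic// ?setIT ?lte_mul_pinfty ?lee_fin ?powR_ge0//.
  exact: lebesgue2_box_lty.
exact: measurable_box.
Qed.

Lemma dyadic_stepD {R : realType} (H1 H2 : plane R -> R) :
  dyadic_step H1 -> dyadic_step H2 -> dyadic_step (H1 \+ H2).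
Proof.
move=> [n [N [B [sH HB H0]]]] [n' [N' [B' [sH' HB' H0']]]].
exists (maxn n n'), (maxn N N'), (B + B'); split.
- move=> X Y XY /=; congr (_ + _); [apply: sH|apply: sH'].
    exact: (dyadic_indexS (leq_maxl _ _) XY).
  exact: (dyadic_indexS (leq_maxr _ _) XY).
- by move=> X /=; rewrite (le_trans (ler_normD _ _))// lerD.
- move=> X nX; have [nB nB'] : ~ box R N X /\ ~ box R N' X.
    split => BX; apply: nX.
      exact: (box_nondecreasing (leq_maxl N N') _ BX).
    exact: (box_nondecreasing (leq_maxr N N') _ BX).
  by rewrite /= H0// H0'// addr0.
Qed.

Lemma dyadic_stepN {R : realType} (H : plane R -> R) :
  dyadic_step H -> dyadic_step (\- H).
Proof.
move=> [n [N [B [sH HB H0]]]]; exists n, N, B.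
split => [X Y /sH /= ->//|X /=|X /H0 /= ->].
  by rewrite normrN.
by rewrite oppr0.
Qed.

Lemma dyadic_step_indic {R : realType} (a : R) n N (E : set (plane R)) :
  dyadic_saturated n E -> dyadic_step (fun X => a * \1_(E `&` box R N) X).
Proof.
move=> sE; exists n, N, `|a|; split.
- move=> X Y XY; congr (_ * _).
  have sEB : dyadic_saturated n (E `&` box R N).
    apply: dyadic_saturatedI => //.
    exact: (dyadic_saturatedS (leq0n n) (@dyadic_saturated_box R N)).
  rewrite !indicE; congr (_%:R); congr nat_of_bool.
  by apply/idP/idP; rewrite !inE; apply: sEB.
- by move=> X; rewrite normrM ler_piMr// indicE; case: (_ \in _); rewrite ?normr1 ?normr0.
- by move=> X nX; rewrite indicE memNset ?mulr0// => -[].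
Qed.

Section dyadic_step_density.
Context {R : realType} (r : R).
Hypothesis r1 : 1 <= r.
Notation leb2 := (lebesgue2 R).

Let r0 : 0 < r. Proof. by rewrite (lt_le_trans ltr01). Qed.

Definition dyadic_step_approximable (F : plane R -> R) :=
  measurable_fun setT F /\ forall e : R, 0 < e -> exists2 H,
    dyadic_step H & ('N[leb2]_r%:E[EFin \o (F \- H)%R] <= e%:E)%E.

Lemma dyadic_step_approximableD F G : dyadic_step_approximable F ->
  dyadic_step_approximable G -> dyadic_step_approximable (F \+ G).
Proof.
move=> [mF hF] [mG hG]; split; first exact: measurable_funD.
move=> e e0; have e20 : 0 < e / 2 by rewrite divr_gt0.
have [H sH FH] := hF _ e20; have [H' sH' GH'] := hG _ e20.
exists (H \+ H'); first exact: dyadic_stepD.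
have -> : EFin \o ((F \+ G) \- (H \+ H')) = EFin \o ((F \- H) \+ (G \- H')).
  by apply/funext => X /=; rewrite opprD addrACA.
rewrite [e]splitr EFinD; apply: le_trans (leeD FH GH').
by apply: minkowski_EFin => //; apply: measurable_funB => //;
  exact: measurable_dyadic_step.
Qed.

Lemma dyadic_step_approximableN F : dyadic_step_approximable F ->
  dyadic_step_approximable (\- F).
Proof.
move=> [mF hF]; split; first exact: measurableT_comp.
move=> e /hF [H sH FH]; exists (\- H); first exact: dyadic_stepN.
have -> : EFin \o ((\- F) \- (\- H)) = (\- (EFin \o (F \- H)%R))%E.
  by apply/funext => X /=; rewrite -opprD.
by rewrite oppe_Lnorm.
Qed.

Lemma dyadic_step_approximable_closed (F : plane R -> R) : measurable_fun setT F ->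
  (forall e : R, 0 < e -> exists2 G, dyadic_step_approximable G &
     ('N[leb2]_r%:E[EFin \o (F \- G)%R] <= e%:E)%E) ->
  dyadic_step_approximable F.
Proof.
move=> mF hF; split => // e e0; have e20 : 0 < e / 2 by rewrite divr_gt0.
have [G [mG hG] FG] := hF _ e20; have [H sH GH] := hG _ e20.
exists H => //.
have -> : EFin \o (F \- H) = EFin \o ((F \- G) \+ (G \- H)).
  by apply/funext => X /=; rewrite addrA subrK.
rewrite [e]splitr EFinD; apply: le_trans (leeD FG GH).
by apply: minkowski_EFin => //; apply: measurable_funB => //;
  exact: measurable_dyadic_step.
Qed.

Lemma dyadic_step_approximable_indic (a : R) (A : set (plane R)) N :
  measurable A -> dyadic_step_approximable (fun X => a * \1_(A `&` box R N) X).
Proof.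
move=> mA; have mB := @measurable_box R N; split.
  apply: measurable_funM => //; apply: measurable_indic; exact: measurableI.
move=> e e0.
pose mu : {measure set (plane R) -> \bar R} := mrestr leb2 mB.
have mufin : (mu setT < +oo)%E.
  by rewrite /mu /= /mrestr setTI; exact: lebesgue2_box_lty.
have ar0 : 0 < `|a| `^ r + 1 by rewrite ltr_wpDl// powR_ge0.
(* Chosen so that [|a|^r] times it is at most [e^r]; the added 1 covers [a = 0]. *)
have d0 : 0 < e `^ r / (`|a| `^ r + 1) by rewrite divr_gt0// powR_gt0.
have [n [E sE AE]] := (@dyadic_approximation R mu mufin A mA).2 _ d0.
have mE := measurable_dyadic_saturated sE.
exists (fun X => a * \1_(E `&` box R N) X); first exact: dyadic_step_indic sE.
apply: Lnorm_le => //; first exact: ltW.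
have mY : measurable ((A `+` E) `&` box R N).
  by apply: measurableI => //; apply: measurableU; exact: measurableD.
rewrite (eq_integral (fun X =>
    (`|a| `^ r)%:E * (\1_((A `+` E) `&` box R N) X)%:E)%E); last first.
  move=> X _; rewrite -EFinM; congr EFin.
  rewrite /= -mulrBr normrM powRM//; congr (_ * _).
  rewrite !indicE 3!in_setI /setY in_setU 2!in_setD.
  by case: (X \in A); case: (X \in E); case: (X \in box R N);
    rewrite /= ?subrr ?subr0 ?sub0r
     ?normrN ?normr0 ?normr1 ?powR1 ?(powR0 (lt0r_neq0 r0)).
rewrite ge0_integralZl_EFin ?powR_ge0//; last first.
  by apply/measurable_EFinP; exact: measurable_indic.
rewrite integral_indic// setIT.
apply: (@le_trans _ _ ((`|a| `^ r)%:E * (e `^ r / (`|a| `^ r + 1))%:E)%E).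
  by rewrite lee_wpmul2l ?lee_fin ?powR_ge0//; exact: ltW.
rewrite -EFinM lee_fin mulrA ler_pdivrMr// mulrC ler_wpM2l ?powR_ge0//.
by rewrite lerDl.
Qed.

End dyadic_step_density.

Section dyadic_step_dense.
Context {R : realType} {r : R}.
Hypothesis r1 : 1 <= r.
Notation leb2 := (lebesgue2 R).
Import HBNNSimple.

Let r0 : 0 < r. Proof. by rewrite (lt_le_trans ltr01). Qed.

Lemma dyadic_step_approximable_nnsfun (h : {nnsfun plane R >-> R}) N :
  dyadic_step_approximable r (fun X => h X * \1_(box R N) X).
Proof.
have [s ->] : exists s : seq R, (fun X => h X * \1_(box R N) X) =
    (fun X => \sum_(y <- s) y * \1_(h @^-1` [set y] `&` box R N) X).
  eexists; apply/funext => X; rewrite [in LHS]fimfunE fsbig_finite//= mulr_suml.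
  by apply: eq_bigr => y _; rewrite -mulrA indicI.
elim: s => [|y s ih].
  under eq_fun do rewrite big_nil.
  have := dyadic_step_approximable_indic r r1 0 set0 N measurable0.
  by under eq_fun do rewrite mul0r.
under eq_fun do rewrite big_cons.
apply: (dyadic_step_approximableD r r1 _ _ _ ih).
exact: dyadic_step_approximable_indic.
Qed.

(** Simple functions that increase to [F], cut off to growing boxes, stay between 0 and [F]. Hence
    [|F|^r] dominates the [r]-th power of the error, which tends to 0 pointwise. *)
Lemma dyadic_step_approximable_ge0 (F : plane R -> R) :
  measurable_fun setT F -> (forall X, 0 <= F X) ->
  (\int[leb2]_X (`|F X| `^ r)%:E < +oo)%E -> dyadic_step_approximable r F.
Proof.
move=> mF F0 Ffin; apply: dyadic_step_approximable_closed => // e e0.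
have mE : measurable_fun setT (EFin \o F) by exact/measurable_EFinP.
pose h := nnsfun_approx measurableT mE.
pose G k X := h k X * \1_(box R k) X.
have mG k : measurable_fun setT (G k).
  by apply: measurable_funM => //; apply: measurable_indic; exact: measurable_box.
have mFr : measurable_fun setT (fun X => (`|F X| `^ r)%:E).
  exact: measurable_normr_powR.
have ig : leb2.-integrable setT (fun X => (`|F X| `^ r)%:E).
  apply/integrableP; split => //.
  by under eq_integral do rewrite gee0_abs ?lee_fin ?powR_ge0//.
have hF X : h ^~ X @ \oo --> F X.
  have E0 x : [set: plane R] x -> (0 <= (EFin \o F) x)%E by rewrite lee_fin.
  by have /fine_cvgP[_] := @cvg_nnsfun_approx _ _ _ _ measurableT _ mE E0 X I.
have GF X : G ^~ X @ \oo --> F X.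
  have [m _ mX] : (\bigcup_N box R N) X by rewrite bigcup_box.
  apply: cvg_trans (hF X); apply: near_eq_cvg; near=> k.
  rewrite /G indicE mem_set ?mulr1//.
  by apply: (box_nondecreasing _ _ mX); near: k; exact: nbhs_infty_ge.
have h_le k X : h k X <= F X.
  rewrite -lee_fin /h nnsfun_approxE.
  have E0 x : [set: plane R] x -> (0 <= (EFin \o F) x)%E by rewrite lee_fin.
  by apply: le_approx.
have mFG k : measurable_fun setT (fun X => (`|(F \- G k) X| `^ r)%:E).
  by apply: measurable_normr_powR; exact: measurable_funB.
have FG0 : {ae leb2, forall X, setT X ->
    (`|(F \- G k) X| `^ r)%:E @[k --> \oo] --> 0%E}.
  apply: aeW => X _; apply: cvg_normr_powR => //.
  by rewrite -(subrr (F X)); apply: cvgB => //; exact: cvg_cst.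
have FGle : {ae leb2, forall X k, setT X ->
    (`|(`|(F \- G k) X| `^ r)%:E| <= (`|F X| `^ r)%:E)%E}.
  apply: aeW => X k _; rewrite gee0_abs ?lee_fin ?powR_ge0//.
  apply: ge0_ler_powR; rewrite ?nnegrE ?(ltW r0)//=.
  have Gk0 : 0 <= G k X by rewrite mulr_ge0.
  have GkF : G k X <= F X.
    by apply: le_trans (h_le k X); rewrite ler_piMr// indicE; case: (_ \in _).
  by rewrite !ger0_norm ?subr_ge0// gerBl.
have [_ _] := dominated_convergence measurableT mFG (measurable_cst 0%E) FG0 ig FGle.
rewrite integral_cst// mul0e => /(_ [set x | (x < (e `^ r)%:E)%E]) [].
  apply: open_nbhs_nbhs; split; first exact: open_ereal_lt_ereal.
  by rewrite /= lte_fin powR_gt0.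
move=> k _ /(_ k (leqnn k)) /= /ltW FGk; exists (G k); last first.
  by apply: Lnorm_le => //; exact: ltW.
exact: dyadic_step_approximable_nnsfun.
Unshelve. all: by end_near. Qed.

Lemma dyadic_step_approximable_Lfun (F : plane R -> R) :
  F \in Lfun leb2 r%:E -> dyadic_step_approximable r F.
Proof.
move=> /in_LfunP[mF] /(fun h => @poweR_lty _ _ r h).
rewrite Lnorm_powR ?gt_eqF// => Ffin.
have part (G : plane R -> R) : measurable_fun setT G -> (forall X, 0 <= G X) ->
    (forall X, G X <= `|F X|) -> dyadic_step_approximable r G.
  move=> mG G0 GF; apply: dyadic_step_approximable_ge0 => //.
  apply: le_lt_trans Ffin; apply: ge0_le_integral => //.
  - exact: measurable_normr_powR.
  - exact: measurable_normr_powR.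
  - move=> X _; rewrite lee_fin ge0_ler_powR ?nnegrE ?(ltW r0)//.
    by rewrite ger0_norm.
have -> : F = (fun X => Num.max (F X) 0) \+ (\- (fun X => Num.max (- F X) 0)).
  apply/funext => X /=; case: (lerP 0 (F X)) => FX.
    by rewrite max_r ?subr0// oppr_le0.
  by rewrite max_l ?oppr_ge0 ?ltW// opprK add0r.
apply: dyadic_step_approximableD => //; last apply: dyadic_step_approximableN.
- apply: part => X; first by apply: measurable_maxr.
  + by rewrite le_max lexx orbT.
  + by rewrite ge_max ler_norm normr_ge0.
- apply: part => X.
  + by apply: measurable_maxr => //; exact: measurableT_comp.
  + by rewrite le_max lexx orbT.
  + by rewrite ge_max -normrN ler_norm normr_ge0.
Qed.

End dyadic_step_dense.

(** * Convergence of the averages *)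

Lemma floor_locally_constant {R : realType} (p x : R) : 0 < p ->
  (Num.floor (p * x))%:~R != p * x ->
  exists2 d, 0 < d &
    forall y, `|y - x| <= d -> Num.floor (p * y) = Num.floor (p * x).
Proof.
move=> p0 nx; set k := Num.floor (p * x).
have /andP[kx xk] : k%:~R <= p * x < (k + 1)%:~R by exact: floor_itv.
have {nx}kx : k%:~R < p * x by rewrite lt_neqAle nx.
(* Half the distance to the nearer of the integers [k] and [k + 1]: halving keeps [p * y] strictly
   below [k + 1] even when [|y - x| = d]. *)
pose a := Num.min (p * x - k%:~R) ((k + 1)%:~R - p * x) / 2.
have a0 : 0 < a by rewrite divr_gt0// lt_min !subr_gt0 kx.
have [a1 a2] : 2 * a <= p * x - k%:~R /\ 2 * a <= (k + 1)%:~R - p * x.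
  by rewrite /a mulrC divfK//; split; rewrite ge_min lexx ?orbT.
exists (a / p); first by rewrite divr_gt0.
move=> y; rewrite ler_pdivlMr// -[X in _ * X](gtr0_norm p0) -normrM mulrBl.
rewrite ![_ * p]mulrC ler_norml => /andP[y1 y2]; apply/eqP; rewrite floor_eq.
by apply/andP; split; lra.
Qed.

Lemma ae_off_dyadic_grid {R : realType} n :
  \forall X \ae lebesgue2 R,
    (Num.floor (2 ^+ n * (X.1 : R)))%:~R != 2 ^+ n * (X.1 : R) /\
    (Num.floor (2 ^+ n * (X.2 : R)))%:~R != 2 ^+ n * (X.2 : R).
Proof.
(* The coordinates of the grid lines. [S] is countable, hence null, and so are the families of
   vertical and horizontal lines over it. *)
pose S : set (measurableTypeR R) := range (fun i : int => i%:~R / 2 ^+ n).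
have cS : countable S by apply: sub_countable (card_image_le _ _) (countableP _).
have mS : measurable S by apply: countable_measurable => //.
have S0 : lebesgue_measure S = 0%E by exact: countable_lebesgue_measure0.
have SP (x : R) : (Num.floor (2 ^+ n * x))%:~R = 2 ^+ n * x -> S x.
  move=> h; exists (Num.floor (2 ^+ n * x)) => //.
  by rewrite h mulrAC divff ?mul1r// expf_neq0.
exists ((S `*` setT) `|` (setT `*` S)); split.
- by apply: measurableU; exact: measurableX.
- apply: null_set_setU; [exact: measurableX|exact: measurableX| |].
  + by rewrite lebesgue2_rect// S0 mul0e.
  + by rewrite lebesgue2_rect// S0 mule0.
move=> X /= /not_andP[|] /negP; rewrite negbK => /eqP /SP; by [left|right].
Qed.

Section line_average_step.
Context {R : realType} {K : R} {v : R * R -> R * R}.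
Hypothesis vK : unit_lipschitz_field K v.
Notation leb := (@lebesgue_measure R).
Notation leb2 := (lebesgue2 R).

(** Here the unit length of the field enters. *)
Lemma flow_close s X :
  `|(flow v s X).1 - X.1| <= `|s| /\ `|(flow v s X).2 - X.2| <= `|s|.
Proof.
have addKB (a b : R) : a + b - a = b by rewrite addrC addKr.
rewrite /flow /= !addKB !normrM.
have v1 := vK.1 X; split; rewrite ler_piMr// -v1.
- exact: ler_norm1_euclid.
- exact: ler_norm2_euclid.
Qed.

Lemma line_average_cst (t c : R) (F : plane R -> R) X : t != 0 ->
  (forall s, `|s| <= `|t| -> F (flow v s X) = c) -> line_average v t F X = c.
Proof.
move=> t0 Fc; rewrite line_averageE//.
rewrite (@eq_Rintegral _ _ _ _ _ (cst c)); last first.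
  by move=> s; rewrite inE /= in_itv /= -ler_norml => /Fc.
rewrite Rintegral_cst; last exact: measurable_centered.
rewrite [X in fine X]lebesgue_measure_centered//= mulrCA mulVf ?mulr1//.
by rewrite mulf_neq0// normr_eq0.
Qed.

Lemma line_average_bounded (t B : R) (F : plane R -> R) X : t != 0 ->
  measurable_fun setT F -> (forall X, `|F X| <= B) -> `|line_average v t F X| <= B.
Proof.
move=> t0 mF FB; have tp : 0 < `|t| by rewrite normr_gt0.
have mline := measurableT_comp mF (measurable_flow_line X vK).
rewrite line_averageE// -lee_fin.
have := jensen_average `|t| 1 _ tp (lexx _) mline.
rewrite powRr1// => /le_trans; apply.
apply: (@le_trans _ _ (((2 * `|t|)^-1)%:E * \int[leb]_(s in centered `|t|) B%:E)%E).
  rewrite lee_pmul2l ?lte_fin ?invr_gt0 ?mulr_gt0//.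
  apply: ge0_le_integral => //.
  - by apply: measurable_normr_powR; exact: measurable_funTS.
  - by move=> s _; rewrite lee_fin powRr1//=; exact: FB.
rewrite integral_cst; last exact: measurable_centered.
rewrite [X in (_ * (_ * X))%E]lebesgue_measure_centered// -!EFinM lee_fin.
by rewrite mulrCA mulVf ?mulr1// mulf_neq0// gt_eqF.
Qed.

(** Short segments from [X] stay inside its cell, where [H] is constant. The radius [d] shrinks as
    [X] approaches the grid, so the convergence is only pointwise. *)
Lemma line_average_step_cvg (H : plane R -> R) X n :
  (forall X Y, dyadic_index n X = dyadic_index n Y -> H X = H Y) ->
  (Num.floor (2 ^+ n * (X.1 : R)))%:~R != 2 ^+ n * (X.1 : R) ->
  (Num.floor (2 ^+ n * (X.2 : R)))%:~R != 2 ^+ n * (X.2 : R) ->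
  exists2 d, 0 < d & forall t, t != 0 -> `|t| <= d -> line_average v t H X = H X.
Proof.
move=> sH X1 X2; have p0 : 0 < 2 ^+ n :> R by rewrite exprn_gt0.
have [d1 d10 hd1] := floor_locally_constant _ _ p0 X1.
have [d2 d20 hd2] := floor_locally_constant _ _ p0 X2.
exists (Num.min d1 d2); first by rewrite lt_min d10.
move=> t t0; rewrite le_min => /andP[td1 td2].
apply: line_average_cst => // s st; apply: sH.
have [s1 s2] := flow_close s X.
congr pair; [apply: hd1|apply: hd2]; [apply: le_trans s1 _|apply: le_trans s2 _];
  exact: le_trans st _.
Qed.

(** A displacement of length at most 1 cannot enter the box from outside the one enlarged by 1. This
    gives all averages with [|t| <= 1] a common support. *)
Lemma line_average_support (t : R) (F : plane R -> R) N X :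
  t != 0 -> `|t| <= 1 -> (forall X, ~ box R N X -> F X = 0) ->
  ~ box R N.+1 X -> line_average v t F X = 0.
Proof.
move=> t0 t1 F0 NX; apply: line_average_cst => // s st; apply: F0 => BX.
apply: NX; have [s1 s2] := flow_close s X.
move: BX s1 s2; rewrite /box /= !in_itv /= => -[/andP[? ?] /andP[? ?]].
rewrite !ler_norml => /andP[? ?] /andP[? ?].
by rewrite -natr1; split; apply/andP; split; lra.
Qed.

Lemma line_average_dyadic_step (r : R) (H : plane R -> R) : 1 <= r -> dyadic_step H ->
  forall e : R, 0 < e -> exists2 d, 0 < d & forall t, 0 < `|t| -> `|t| <= d ->
    ('N[leb2]_r%:E[EFin \o (line_average v t H \- H)%R] <= e%:E)%E.
Proof.
move=> r1 sH e e0; have r0 : 0 < r by rewrite (lt_le_trans ltr01).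
have mH := measurable_dyadic_step H sH.
move: sH => [n [N [B [sH HB H0]]]].
(* By contradiction, as dominated convergence is about sequences of times. *)
apply: contrapT => nd.
have /choice[t ht] : forall k : nat, exists t, [/\ t != 0, `|t| <= k.+1%:R^-1 &
    ~ ('N[leb2]_r%:E[EFin \o (line_average v t H \- H)%R] <= e%:E)%E].
  move=> k; apply: contrapT => nt; apply: nd; exists k.+1%:R^-1 => [|t t0 tk].
    by rewrite invr_gt0.
  by apply: contrapT => nN; apply: nt; exists t; split => //; rewrite -normr_gt0.
have t0 k : t k != 0 by have [] := ht k.
have tk k : `|t k| <= k.+1%:R^-1 by have [] := ht k.
have t1 k : `|t k| <= 1 by rewrite (le_trans (tk k))// invf_le1// ler1n.
have mM k := measurable_line_average vK (t k) H (t0 k) mH.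
have mf k : measurable_fun [set: plane R]
    (fun X : plane R => (`|(line_average v (t k) H \- H) X| `^ r)%:E).
  exact: measurable_normr_powR (measurable_funB (mM k) mH).
have f0 : {ae leb2, forall X : plane R, [set: plane R] X ->
   (`|(line_average v (t k) H \- H) X| `^ r)%:E @[k --> \oo] --> 0%E}.
  have [M [mM' M0 gridM]] := @ae_off_dyadic_grid R n; exists M; split => //.
  apply: subset_trans gridM; apply: subsetC => X [X1 X2] _.
  have [d d0 hd] := line_average_step_cvg H X n sH X1 X2.
  apply: cvg_normr_powR => //; apply: cvg_near_cst.
  near=> k; rewrite /= hd ?subrr//.
  apply: (le_trans (tk k)); apply: ltW; near: k.
  exact: (near_infty_natSinv_lt (PosNum d0)).
(* The average and [H] are both bounded by [B] and both vanish off the enlarged box, so one majorant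
   serves all [k]. *)
pose g : plane R -> \bar R := fun X => (((B + B) `^ r)%:E * (\1_(box R N.+1) X)%:E)%E.
have mB := @measurable_box R N.+1.
have mg : measurable_fun setT g.
  by apply/measurable_EFinP; apply: measurable_funM => //; exact: measurable_indic.
have ig : leb2.-integrable setT g.
  apply/integrableP; split => //.
  under eq_integral do rewrite gee0_abs ?mule_ge0 ?lee_fin ?powR_ge0//.
  rewrite ge0_integralZl_EFin ?powR_ge0//; last first.
    by apply/measurable_EFinP; exact: measurable_indic.
  rewrite integral_indic// setIT lte_mul_pinfty ?lee_fin ?powR_ge0//.
  exact: lebesgue2_box_lty.
have fg : {ae leb2, forall (X : plane R) k, [set: plane R] X ->
    (`|(`|(line_average v (t k) H \- H) X| `^ r)%:E| <= g X)%E}.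
  apply: aeW => X k _; rewrite gee0_abs; last by rewrite lee_fin powR_ge0.
  rewrite /g -EFinM lee_fin indicE.
  case: (boolP (X \in box R N.+1)) => [_|].
    rewrite mulr1 ge0_ler_powR ?nnegrE ?(ltW r0)//.
      by rewrite addr_ge0// (le_trans _ (HB X)).
    rewrite (le_trans (ler_normB _ _))// lerD//.
    exact: line_average_bounded.
  rewrite notin_setE => NX; rewrite /= (line_average_support (t k) H N)// H0.
    by rewrite subrr normr0 powR0 ?gt_eqF// mulr0.
  by move=> BX; apply: NX; exact: (box_nondecreasing (leqnSn N) _ BX).
have [_ _] := dominated_convergence measurableT mf (measurable_cst 0%E) f0 ig fg.
rewrite integral_cst// mul0e => /(_ [set x | (x < (e `^ r)%:E)%E]) [].
  apply: open_nbhs_nbhs; split; first exact: open_ereal_lt_ereal.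
  by rewrite /= lte_fin powR_gt0.
move=> k _ /(_ k (leqnn k)) /= /ltW fk; have [_ _] := ht k; apply.
by apply: Lnorm_le => //; exact: ltW.
Unshelve. all: by end_near. Qed.

End line_average_step.

Lemma dyadic_step_Lfun {R : realType} (r : R) (H : plane R -> R) : 0 < r ->
  dyadic_step H -> H \in Lfun (lebesgue2 R) r%:E.
Proof.
move=> r0 sH; apply/in_LfunP; split; first exact: measurable_dyadic_step.
have := integral_powR_dyadic_step_lty H r r0 sH.
by rewrite -Lnorm_powR ?gt_eqF//; apply: lty_poweRy; rewrite gt_eqF.
Qed.

Lemma Lnorm_ae_eq {d} {X : measurableType d} {R : realType}
    (mu : {measure set X -> \bar R}) (F G : X -> R) (r : R) :
  measurable_fun setT F -> measurable_fun setT G -> F = G %[ae mu] ->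
  ('N[mu]_r%:E[EFin \o F] = 'N[mu]_r%:E[EFin \o G])%E.
Proof.
move=> mF mG FG; rewrite unlock /=; congr (_ `^ _)%E.
apply: ae_eq_integral => //; try exact: measurable_normr_powR.
by apply: filterS FG => x /= /[apply] ->.
Qed.

Section line_average_convergence.
Context {R : realType} {K T : R} {v : R * R -> R * R}.
Hypotheses (vK : unit_lipschitz_field K v) (K0 : 0 < K) (T0 : 0 < T) (TK : T < 1 / K).
Notation leb := (@lebesgue_measure R).
Notation leb2 := (lebesgue2 R).

Lemma line_average_cvg (r : R) (F : plane R -> R) : 1 <= r ->
  F \in Lfun leb2 r%:E ->
  forall e : R, 0 < e -> exists2 d, 0 < d & forall t, 0 < `|t| -> `|t| <= d ->
    ('N[leb2]_r%:E[EFin \o (line_average v t F \- F)%R] <= e%:E)%E.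
Proof.
move=> r1 LF e e0; have r0 : 0 < r by rewrite (lt_le_trans ltr01).
have [mF _] := (in_LfunP _ _ _).1 LF.
set C' : R := distortion (1 - T * K) `^ r^-1.
have C'0 : 0 <= C' by exact: powR_ge0.
(* The error splits into three terms: the average of [F - H], which costs [C' * e'], and [M_t H - H]
   and [H - F], which cost [e'] each. *)
pose e' := e / (C' + 2).
have C2 : 0 < C' + 2 by rewrite ltr_wpDl.
have e'0 : 0 < e' by rewrite divr_gt0.
have [_ /(_ _ e'0) [H sH FH]] := dyadic_step_approximable_Lfun r1 F LF.
have mH := measurable_dyadic_step H sH.
have LH := dyadic_step_Lfun r H r0 sH.
have [d d0 hd] := line_average_dyadic_step vK r H r1 sH _ e'0.
(* The cap by [T] keeps [t] in the range of the uniform norm bound. *)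
exists (Num.min d T); first by rewrite lt_min d0.
move=> t t0; rewrite le_min => /andP[td tT].
have tn0 : t != 0 by rewrite -normr_gt0.
have mD : measurable_fun setT (F \- H) by exact: measurable_funB.
have mMD := measurable_line_average vK t _ tn0 mD.
have mMF := measurable_line_average vK t _ tn0 mF.
have mMH := measurable_line_average vK t _ tn0 mH.
have m2 := measurable_funB mMH mH.
have m3 := measurable_funB mH mF.
have m23 := measurable_funD m2 m3.
(* The average of [F - H] splits only where [F] and [H] are integrable along the segment, so the
   decomposition is an identity almost everywhere. *)
rewrite (@Lnorm_ae_eq _ _ _ leb2 _
  (line_average v t (F \- H) \+ ((line_average v t H \- H) \+ (H \- F)))); last first.
- have iF := ae_line_integrable vK K0 TK `|t| r%:E F (normr_ge0 t) tT r1 LF.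
  have iH := ae_line_integrable vK K0 TK `|t| r%:E H (normr_ge0 t) tT r1 LH.
  apply: filterS2 iF iH => X iF iH _.
  have -> : (line_average v t (F \- H) \+ ((line_average v t H \- H) \+ (H \- F))) X =
      line_average v t (F \- H) X + (line_average v t H X - H X + (H X - F X)) by [].
  have -> : line_average v t (F \- H) X = line_average v t F X - line_average v t H X.
    rewrite !line_averageE// -mulrBr -RintegralB//; exact: measurable_centered.
  have subDD (a b c d' : R) : a - d' = a - b + (b - c + (c - d')) by ring.
  exact: subDD.
- exact: measurable_funD mMD m23.
- exact: measurable_funB mMF mF.
have h1 := Lnorm_line_average vK K0 TK t r _ t0 tT r1 mD.
have h2 := hd t t0 td.
have h3 : ('N[leb2]_r%:E[EFin \o (H \- F)%R] <= e'%:E)%E.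
  apply: le_trans FH; rewrite -[leRHS]oppe_Lnorm le_eqVlt; apply/orP; left.
  by apply/eqP; apply: eq_Lnorm => X /=; rewrite opprB.
apply: (le_trans (minkowski_EFin leb2 mMD m23 r1)).
have -> : e%:E = ((C' * e')%:E + (e'%:E + e'%:E))%E.
  rewrite -!EFinD; congr EFin; rewrite /e'; field; exact: lt0r_neq0.
apply: leeD.
  apply: (le_trans h1); rewrite EFinM lee_wpmul2l ?lee_fin//.
apply: (le_trans (minkowski_EFin leb2 m2 m3 r1)).
exact: leeD.
Qed.

End line_average_convergence.

(** The first part unfolds what it means for [M_t] to act on classes in [L^p]: the defining integral
    exists almost everywhere, the result is in [L^p], and another representative [G] of the class,
    measurable or not, gives the same class. *)
Theorem proposition1 (R : realType) (v : R * R -> R * R) (K T : R)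
    (K_gt0 : 0 < K) (v_field : unit_lipschitz_field K v)
    (T_gt0 : 0 < T) (T_ltVK : T < 1 / K) :
  (forall (t : R) (p : \bar R), 0 < `|t| -> `|t| <= T -> (1 <= p)%E ->
     forall F : R * R -> R, F \in Lfun (lebesgue2 R) p ->
     [/\ \forall X \ae lebesgue2 R,
           (@lebesgue_measure R).-integrable `[- `|t|, `|t|]
             (fun s : R => (F ((X : R * R) + s *: v X))%:E),
         line_average v t F \in Lfun (lebesgue2 R) p
       & forall G : R * R -> R, F = G %[ae lebesgue2 R] ->
           line_average v t F = line_average v t G %[ae lebesgue2 R]])
  /\
  (forall p : \bar R, (1 <= p)%E -> (p < +oo)%E ->
     forall F : R * R -> R, F \in Lfun (lebesgue2 R) p ->
     'N[lebesgue2 R]_p[EFin \o (line_average v t F \- F)%R]%E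
       @[t --> (0 : R)^'] --> 0%E).
Proof.
split=> [t p t0 tT p1 F LF|p p1 py F LF].
  split.
  - exact: (ae_line_integrable v_field K_gt0 T_ltVK `|t| p F (normr_ge0 t) tT p1 LF).
  - exact: (line_average_Lfun v_field K_gt0 T_ltVK t p F t0 tT p1 LF).
  - move=> G FG.
    exact: (line_average_ae_eq v_field K_gt0 T_ltVK t F G t0 tT FG).
case: p p1 py LF => [r| |]//; rewrite lee_fin => r1 _ LF.
have cv := line_average_cvg v_field K_gt0 T_gt0 T_ltVK r F r1 LF.
have near_le (e : R) : 0 < e -> \forall t \near (0 : R)^',
    ('N[lebesgue2 R]_r%:E[EFin \o (line_average v t F \- F)%R] <= e%:E)%E.
  move=> /cv[d d0 hd]; exists d => //= t /=.
  by rewrite sub0r normrN => /ltW td tn0; apply: hd => //; rewrite normr_gt0.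
(* Convergence in the extended reals amounts to finiteness near 0, obtained from the bound with
   [e = 1], and convergence of the real values. *)
apply/fine_cvgP; split.
  apply: filterS (near_le 1 ltr01) => t h.
  by rewrite ge0_fin_numE ?Lnorm_ge0// (le_lt_trans h)// ltry.
apply/cvgrPdist_le => e e0; apply: filterS (near_le e e0) => t h.
rewrite sub0r normrN ger0_norm ?fine_ge0 ?Lnorm_ge0//= -lee_fin fineK//.
by rewrite ge0_fin_numE ?Lnorm_ge0// (le_lt_trans h)// ltry.
Qed.
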